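(* Let $n\ge2$, let $\omega$ be a majorant, $\nu\in[2,+\infty)$, $\alpha>0$ and $\beta\le\alpha$. Suppose that $u\in\mathcal{C}^2(\mathbb{B}^n)$ is a real-valued solution of $\Delta u=\lambda(x)u$ in $\mathbb{B}^n$, where $\lambda:\mathbb{B}^n\to\mathbb{R}$ is a nonnegative continuous function with $\sup_{x\in\mathbb{B}^n}\lambda(x)<\frac{2n}{\nu}$, and suppose $$\|u\|:=|u(0)|+\sup_{x\in\mathbb{B}^n}\left\{M_\nu(|\nabla u|,|x|)\,\omega\big(\phi(|x|)\big)\right\}<+\infty .$$ For $r\in[0,1)$ put $C^{*}=\left(1-\frac{r^2\nu}{2n}\sup_{x\in\mathbb{B}^n}\lambda(x)\right)^{1/2}$. If $n\ge3$, then for all $r\in[0,1)$, $$M_\nu(u,r)\le\frac1{C^{*}}\left(|u(0)|^2+\frac{\nu(\nu-1)}{(n-2)\omega^2(1)}\|u\|^2r^2\int_0^1\frac{t(1-t^{n-2})}{\phi^2(rt)}\,dt\right)^{1/2}.$$ If $n=2$, then for all $r\in[0,1)$, $$M_\nu(u,r)\le\frac1{C^{*}}\left(|u(0)|^2+\frac{\nu(\nu-1)}{\omega^2(1)}\|u\|^2r^2\int_0^1\frac{t\log\frac1t}{\phi^2(rt)}\,dt\right)^{1/2}.$$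
   Context: $\mathbb{B}^n$ is the open unit ball of $\mathbb{R}^n$. A majorant is a continuous increasing function $\omega:[0,+\infty)\to[0,+\infty)$ with $\omega(0)=0$ such that $\omega(t)/t$ is non-increasing for $t>0$. For $s\in[0,1)$, $$\phi(s)=(1-s)^{\alpha}\big(1-\log(1-s)\big)^{\beta}.$$ For a function $f$ on $\mathbb{B}^n$, $\nu\in(0,+\infty)$ and $r\in[0,1)$, $$M_\nu(f,r)=\left(\int_{\partial\mathbb{B}^n}|f(r\zeta)|^\nu\,d\sigma(\zeta)\right)^{1/\nu},$$ where $d\sigma$ is the normalized surface measure on $\partial\mathbb{B}^n$. Here $\omega^2(1)=(\omega(1))^2$ and $\phi^2(rt)=(\phi(rt))^2$. *)

(* Defs.v *)
From HB Require Import structures.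
From mathcomp Require Import all_boot all_order all_algebra.
From mathcomp Require Import all_classical all_reals all_analysis measurable_realfun.

Set Implicit Arguments.
Unset Strict Implicit.
Unset Printing Implicit Defensive.

Import Order.TTheory GRing.Theory Num.Theory.
Import numFieldNormedType.Exports.

Local Open Scope classical_set_scope.
Local Open Scope ring_scope.

(* R^n is 'rV[R]_n. Its library norm is the sup norm, hence a separate
   Euclidean norm; both norms induce the topology used for limits and
   derivatives. *)
Definition enorm {R : realType} {n : nat} (x : 'rV[R]_n) : R :=
  Num.sqrt (\sum_(i < n) x 0 i ^+ 2).

Definition eball (R : realType) (n : nat) : set 'rV[R]_n :=
  [set x | enorm x < 1].
Arguments eball : clear implicits.

Section calculus.
Context {R : realType} {n : nat}.
Implicit Types (D : set 'rV[R]_n) (f : 'rV[R]_n -> R).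

Definition pderiv (i : 'I_n) f : 'rV[R]_n -> R := fun x => 'D_'e_i f x.

Definition grad f (x : 'rV[R]_n) : 'rV[R]_n := \row_i pderiv i f x.

Definition laplacian f (x : 'rV[R]_n) : R :=
  \sum_(i < n) pderiv i (pderiv i f) x.

(* For D open; 'D_'e_i f x is a total function, so existence of the partial
   derivatives is stated separately. *)
Definition C1_on D f : Prop :=
  {in D, continuous f} /\
  forall i, {in D, forall x, derivable f x 'e_i} /\
            {in D, continuous (pderiv i f)}.

Definition C2_on D f : Prop := C1_on D f /\ forall i, C1_on D (pderiv i f).

End calculus.

(* The product sigma-algebra on R^n, i.e. its Borel sets. *)
Definition rV_display : measure_display -> measure_display.
Proof. exact. Qed.

Section measurable_rV.
Context {R : realType} (n : nat).

Let coors : 'I_n -> 'rV[R]_n -> R := fun i x => x 0 i.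

Let rV_set0 : g_sigma_preimage coors set0.
Proof. exact: sigma_algebra0. Qed.

Let rV_setC A : g_sigma_preimage coors A -> g_sigma_preimage coors (~` A).
Proof. exact: sigma_algebraC. Qed.

Let rV_bigcup (F : _^nat) : (forall i, g_sigma_preimage coors (F i)) ->
  g_sigma_preimage coors (\bigcup_i (F i)).
Proof. exact: sigma_algebra_bigcup. Qed.

HB.instance Definition _ := @isMeasurable.Build
  (rV_display default_measure_display)
  'rV[R]_n (g_sigma_preimage coors) rV_set0 rV_setC rV_bigcup.

End measurable_rV.

Lemma measurable_coord (R : realType) n (i : 'I_n) :
  measurable_fun [set: 'rV[R]_n] (fun x : 'rV[R]_n => x 0 i).
Proof.
move=> _ Y mY; rewrite setTI; apply: sub_sigma_algebra => /=.
rewrite -bigcup_seq/=; exists i => /=; first by rewrite mem_index_enum.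
by exists Y => //; rewrite setTI.
Qed.

Lemma measurable_fun_rVP d (T : measurableType d) (R : realType) n
    (f : T -> 'rV[R]_n) :
  measurable_fun [set: T] f <->
  forall i, measurable_fun [set: T] (fun t => f t 0 i).
Proof.
pose c (i : 'I_n) (x : 'rV[R]_n) : R := x 0 i.
apply: (@iff_trans _ (g_sigma_preimage (fun i => c i \o f) `<=` measurable)).
  rewrite g_sigma_preimage_comp; split=> [mf A [/= C preC <-]|prefS].
    exact: mf.
  by move=> _ A mA; apply: prefS; exists A.
split=> [cfS i|mf].
- move=> _ A mA.
  apply: cfS; apply: sub_sigma_algebra => /=.
  rewrite -bigcup_seq/=; exists i => /=; first by rewrite mem_index_enum.
  by exists A.
- apply: smallest_sub; first exact: sigma_algebra_measurable.
  rewrite -bigcup_seq/=; apply: bigcup_sub => i _.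
  by move=> A [B mB <-]; exact: mf.
Qed.

Lemma measurable_enorm (R : realType) n :
  measurable_fun [set: 'rV[R]_n] (@enorm R n).
Proof.
rewrite (_ : @enorm R n = fun x => (\sum_(i < n) x 0 i ^+ 2) `^ 2^-1); last first.
  apply/funext => x; rewrite powR12_sqrt//.
  by rewrite sumr_ge0// => i _; rewrite sqr_ge0.
apply: (@measurableT_comp _ _ _ _ _ _ (@powR R ^~ 2^-1)) => //.
apply: measurable_sum => i; under eq_fun do rewrite expr2.
by apply: measurable_funM; exact: measurable_coord.
Qed.

Lemma measurable_eball (R : realType) n : measurable (eball R n).
Proof.
rewrite (_ : eball R n = (@enorm R n) @^-1` `]-oo, 1[); last first.
  by apply/seteqP; split => x /=; rewrite in_itv.
by rewrite -[X in measurable X]setTI; apply: measurable_enorm.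
Qed.

Section lebesgue_rV.
Context {R : realType}.

Definition rV_cons n (p : R * 'rV[R]_n) : 'rV[R]_n.+1 := row_mx p.1%:M p.2.

Definition rV_uncons n (x : 'rV[R]_n.+1) : R * 'rV[R]_n :=
  (x 0 ord0, \row_i x 0 (lift ord0 i)).

Lemma rV_consE n (p : R * 'rV[R]_n) i :
  rV_cons p 0 i = if unlift ord0 i is Some j then p.2 0 j else p.1.
Proof.
rewrite /rV_cons; case: unliftP => [j|] ->.
  have -> : lift ord0 j = rshift 1 j by exact: val_inj.
  exact: (row_mxEr p.1%:M p.2).
have -> : @ord0 n = lshift n (ord0 : 'I_1) by exact: val_inj.
by rewrite [LHS](row_mxEl p.1%:M p.2) mxE.
Qed.

Lemma rV_unconsK n : cancel (@rV_uncons n) (@rV_cons n).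
Proof.
move=> x; apply/rowP => i; rewrite rV_consE /rV_uncons/=.
by case: unliftP => [j|] ->//; rewrite mxE.
Qed.

Lemma rV_consK n : cancel (@rV_cons n) (@rV_uncons n).
Proof.
move=> [a v]; rewrite /rV_uncons; congr pair.
  by rewrite rV_consE unlift_none.
by apply/rowP => i; rewrite mxE rV_consE liftK.
Qed.

Lemma measurable_rV_cons n : measurable_fun [set: R * 'rV[R]_n] (@rV_cons n).
Proof.
apply/measurable_fun_rVP => i.
under eq_fun do rewrite rV_consE.
case: unliftP => [j _|_]; last exact: measurable_fst.
by apply: (measurableT_comp (@measurable_coord R n j)); exact: measurable_snd.
Qed.

Lemma measurable_rV_uncons n : measurable_fun [set: 'rV[R]_n.+1] (@rV_uncons n).
Proof.
apply: measurable_fun_pair; first exact: measurable_coord.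
apply/measurable_fun_rVP => i.
by under eq_fun do rewrite mxE; exact: measurable_coord.
Qed.

Section step.
Variables (n : nat) (m : {sigma_finite_measure set 'rV[R]_n -> \bar R}).

Definition lebesgue_rV_step : set 'rV[R]_n.+1 -> \bar R :=
  pushforward (@lebesgue_measure R \x m)%E (@rV_cons n).

Let mcons A : measurable A -> measurable (@rV_cons n @^-1` A).
Proof. by move=> mA; rewrite -[X in measurable X]setTI; exact: measurable_rV_cons. Qed.

Let step0 : lebesgue_rV_step set0 = 0%E.
Proof. by rewrite /lebesgue_rV_step /pushforward preimage_set0 measure0. Qed.

Let step_ge0 A : (0 <= lebesgue_rV_step A)%E.
Proof. by rewrite /lebesgue_rV_step /pushforward measure_ge0. Qed.

Let step_sigma_additive : semi_sigma_additive lebesgue_rV_step.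
Proof.
move=> F mF tF mUF; rewrite /lebesgue_rV_step /pushforward preimage_bigcup.
apply: measure_semi_sigma_additive.
- by move=> k; exact: mcons.
- apply/trivIsetP => i j _ _ ij; rewrite -preimage_setI.
  by move/trivIsetP : tF => /(_ _ _ _ _ ij) ->//; rewrite preimage_set0.
- by rewrite -preimage_bigcup; exact: mcons.
Qed.

HB.instance Definition _ := isMeasure.Build _ _ _ lebesgue_rV_step
  step0 step_ge0 step_sigma_additive.

Let step_sigma_finite : sigma_finite setT lebesgue_rV_step.
Proof.
have /sigma_finiteP[F [TF ndF Foo]] := sigma_finiteT (@lebesgue_measure R).
have /sigma_finiteP[G [TG ndG Goo]] := sigma_finiteT m.
exists (fun k => @rV_uncons n @^-1` (F k `*` G k)).
  apply/esym/seteqP; split => // x _.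
  have : setT (rV_uncons x).1 by [].
  rewrite TF => -[i _ Fi].
  have : setT (rV_uncons x).2 by [].
  rewrite TG => -[j _ Gj].
  exists (maxn i j) => //; split.
    by move: Fi; exact/subsetPset/ndF/leq_maxl.
  by move: Gj; exact/subsetPset/ndG/leq_maxr.
move=> k; have [mF Fk] := Foo k; have [mG Gk] := Goo k; split.
  rewrite -[X in measurable X]setTI.
  by apply: measurable_rV_uncons => //; exact: measurableX.
rewrite /lebesgue_rV_step /pushforward -comp_preimage.
rewrite (_ : _ \o _ = id); last by apply/funext; exact: rV_consK.
by rewrite preimage_id product_measure1E// lte_mul_pinfty// ge0_fin_numE.
Qed.

HB.instance Definition _ := Measure_isSigmaFinite.Build _ _ _ lebesgue_rV_step
  step_sigma_finite.

End step.

(* R^n.+1 = R x R^n *)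
Fixpoint lebesgue_rV (n : nat) : {sigma_finite_measure set 'rV[R]_n -> \bar R} :=
  match n with
  | 0 => \d_(0 : 'rV[R]_0)
  | n'.+1 => lebesgue_rV_step (lebesgue_rV n')
  end.

End lebesgue_rV.

Section sphere_measure.
Context {R : realType} (n : nat).

(* {t z | 0 < t < 1, |z| = 1, z in A} *)
Definition cone (A : set 'rV[R]_n) : set 'rV[R]_n :=
  [set x | 0 < enorm x < 1 /\ A ((enorm x)^-1 *: x)].

(* The normalized surface measure of the unit sphere, as a Borel measure on
   R^n carried by the sphere: in polar coordinates, the surface area of A is
   n times the volume of cone A, and that of the sphere n times the volume of
   the ball. *)
Definition sphere_measure (A : set 'rV[R]_n) : \bar R :=
  (((fine (lebesgue_rV n (eball R n)))^-1)%:E * lebesgue_rV n (cone A))%E.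

Lemma measurable_sphere_proj :
  measurable_fun [set: 'rV[R]_n] (fun x : 'rV[R]_n => (enorm x)^-1 *: x).
Proof.
apply/measurable_fun_rVP => i.
rewrite (_ : (fun _ => _) = fun x : 'rV[R]_n => (enorm x) `^ (-1) * x 0 i).
  apply: measurable_funM; last exact: measurable_coord.
  apply: (@measurableT_comp _ _ _ _ _ _ (@powR R ^~ (-1))) => //.
  exact: measurable_enorm.
by apply/funext => x; rewrite mxE powR_inv1// sqrtr_ge0.
Qed.

Lemma measurable_cone A : measurable A -> measurable (cone A).
Proof.
move=> mA; rewrite (_ : cone A = (@enorm R n) @^-1` `]0, 1[ `&`
    (fun x : 'rV[R]_n => (enorm x)^-1 *: x) @^-1` A); last first.
  by apply/seteqP; split => x /=; rewrite in_itv.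
apply: measurableI; rewrite -[X in measurable X]setTI.
  exact: measurable_enorm.
exact: measurable_sphere_proj.
Qed.

Let sphere0 : sphere_measure set0 = 0%E.
Proof.
rewrite /sphere_measure (_ : cone set0 = set0) ?measure0 ?mule0//.
by apply/seteqP; split => x // -[].
Qed.

Let vol_ge0 : 0 <= (fine (lebesgue_rV n (eball R n)))^-1.
Proof. by rewrite invr_ge0 fine_ge0. Qed.

Let sphere_ge0 A : (0 <= sphere_measure A)%E.
Proof. by rewrite /sphere_measure mule_ge0. Qed.

Let sphere_sigma_additive : semi_sigma_additive sphere_measure.
Proof.
move=> F mF tF mUF.
have coneU : cone (\bigcup_k F k) = \bigcup_k cone (F k).
  apply/seteqP; split => [x [x01 [k _ Fkx]]|x [k _ [x01 Fkx]]].
    by exists k.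
  by split => //; exists k.
have tC : trivIset setT (cone \o F).
  apply/trivIsetP => i j _ _ ij; apply/seteqP; split => // x [[_ Fi] [_ Fj]].
  move/trivIsetP : tF => /(_ i j I I ij) FF0.
  by have : (F i `&` F j) ((enorm x)^-1 *: x) by []; rewrite FF0.
have := @measure_semi_sigma_additive _ _ _
  (mscale (NngNum vol_ge0) (lebesgue_rV n)) (cone \o F).
rewrite -coneU; apply => //.
- by move=> k; exact: measurable_cone.
- exact: measurable_cone.
Qed.

HB.instance Definition _ := isMeasure.Build _ _ _ sphere_measure
  sphere0 sphere_ge0 sphere_sigma_additive.

End sphere_measure.
Arguments sphere_measure : clear implicits.

(* M_nu(f, r); it is the usual expression for 0 < nu *)
Definition integral_mean {R : realType} {n : nat} (nu : R) (f : 'rV[R]_n -> R) (r : R) :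
    \bar R :=
  ('N[sphere_measure R n]_nu%:E[EFin \o (fun z => f (r *: z)%R)])%E.

Definition esup_eball {R : realType} {n : nat} (F : 'rV[R]_n -> \bar R) : \bar R :=
  ereal_sup (F @` eball R n).

(* Functions on [0, +oo[ are total functions on R; only their values at
   nonnegative reals are constrained. *)
Definition majorant {R : realType} (omega : R -> R) : Prop :=
  [/\ {within `[0, +oo[, continuous omega},
      forall t, 0 <= t -> 0 <= omega t,
      forall s t, 0 <= s -> s < t -> omega s < omega t,
      omega 0 = 0 &
      forall s t, 0 < s -> s <= t -> omega t / t <= omega s / s].

Definition phi {R : realType} (alpha beta s : R) : R :=
  (1 - s) `^ alpha * (1 - ln (1 - s)) `^ beta.

Definition unorm {R : realType} {n : nat} (omega : R -> R) (nu alpha beta : R)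
    (u : 'rV[R]_n -> R) : \bar R :=
  (`|u 0|%:E + esup_eball (fun x : 'rV[R]_n =>
     integral_mean nu (fun y => enorm (grad u y)) (enorm x)
     * (omega (phi alpha beta (enorm x)))%:E))%E.

(* Main.v *)
Require Import Defs.
From HB Require Import structures.
From mathcomp Require Import all_boot all_order all_algebra.
From mathcomp Require Import all_classical all_reals all_analysis measurable_realfun.
From mathcomp Require Import ring lra.

Set Implicit Arguments.
Unset Strict Implicit.
Unset Printing Implicit Defensive.

Import Order.TTheory GRing.Theory Num.Theory.
Import numFieldNormedType.Exports.

Local Open Scope classical_set_scope.
Local Open Scope ring_scope.

(* The function v = |u|^nu is C^2 with
   Delta v = nu (nu - 1) |u|^(nu-2) |grad u|^2 + nu lambda |u|^nu.
   Its spherical mean I(s) satisfies s I'' + (n-1) I' = s L(s), where L is the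
   spherical mean of Delta v. Instead of Green's formula, this is obtained from
   the vanishing of the spherical means of the rotation derivatives
   y_j d_i F - y_i d_j F, which follows by integrating by parts over R^n the
   products of F(s x / |x|) with radial cutoffs (approximated by smooth
   functions): radial factors are annihilated by rotations. As L >= 0, I is
   nondecreasing, and Young's inequality bounds L(s) on [0, r] by
   nu (nu - 1) A^(nu-2) B(s)^2 + nu (sup lambda) A^nu, where A = M_nu(u, r) and
   B(s) = ||u|| / (omega(1) phi(s)) bounds M_nu(|grad u|, s), because phi <= 1
   and omega(t)/t is nonincreasing. Integrating the differential inequality
   against the radial Green function and dividing by A^(nu-2) gives the bound. *)

(** * Calculus of several variables *)

(** The surface measure is defined through volumes of cones, so an integral over the sphere is a
    Lebesgue integral, over the punctured ball, of a function constant along rays. After a radial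
    cutoff such a function can be integrated by parts on all of R^n, without boundary terms. Taking
    F = y_i d_j v - y_j d_i v, the vanishing of the rotation means says that the spherical Laplacian
    of v, a sum of squares of rotation fields, has mean zero; this is the equation for I, since the
    Laplacian splits into a radial and a spherical part. The assumption nu >= 2 makes |u|^nu twice
    differentiable across the zeros of u. Freezing A at the outer radius r is possible because I is
    monotone, and it leaves the common factor A^(nu-2) to be cancelled. The term nu (sup lambda)
    A^nu does not depend on s. As |x|^2 / (2n) has Laplacian 1, it contributes nu (sup lambda) A^nu
    r^2 / (2n), which is moved to the left-hand side and becomes the constant C*; the bound sup
    lambda < 2n / nu keeps C* positive for every r < 1. *)

Section big_sums.
Context {R : numFieldType} {V W : normedModType R} {I : Type}.

Lemma cvg_sumr T (F : set_system T) (r : seq I) (f : I -> T -> W) (l : I -> W) :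
  Filter F -> (forall i, f i x @[x --> F] --> l i) ->
  (\sum_(i <- r) f i x) @[x --> F] --> \sum_(i <- r) l i.
Proof.
move=> FF fl; elim: r => [|i r ih].
  by rewrite big_nil; under eq_fun do rewrite big_nil; exact: cvg_cst.
by rewrite big_cons; under eq_fun do rewrite big_cons; exact: cvgD.
Qed.

Lemma is_derive_sumr (x v : V) (r : seq I) (f : I -> V -> W) (df : I -> W) :
  (forall i, is_derive x v (f i) (df i)) ->
  is_derive x v (fun y => \sum_(i <- r) f i y) (\sum_(i <- r) df i).
Proof.
move=> fP; elim: r => [|i r ih].
  by rewrite big_nil; under eq_fun do rewrite big_nil; exact: is_derive_cst.
by rewrite big_cons; under eq_fun do rewrite big_cons; exact: is_deriveD.
Qed.

End big_sums.

Lemma is_derive_continuous {R : realType} (f : R -> R) (x d : R) :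
  is_derive x 1 f d -> {for x, continuous f}.
Proof.
by move=> [h _]; apply: differentiable_continuous; exact/derivable1_diffP.
Qed.

Lemma is_deriveXn {R : realType} n (x : R) :
  is_derive x 1 (fun t : R => t ^+ n) (n%:R * x ^+ n.-1).
Proof.
split; first exact: exprn_derivable.
by rewrite exp_derive /GRing.scale/= mulr1.
Qed.

Section chain_rule.
Context {R : realType} {n : nat}.
Implicit Types (f : 'rV[R]_n -> R) (x y : 'rV[R]_n) (k : nat).

(** Both sides are limits of the same difference quotient; derivatives in a direction are thus
    handed to the one-variable rules and back. *)
Lemma is_derive_line f (p e : 'rV[R]_n) (s d : R) :
  is_derive (p + s *: e) e f d <-> is_derive s 1 (fun t => f (p + t *: e)) d.
Proof.
have E : (fun h : R => h^-1 *: (f (h *: e + (p + s *: e)) - f (p + s *: e))) =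
   (fun h => h^-1 *: (f (p + (h *: 1 + s) *: e) - f (p + s *: e))).
  by apply/funext => h; rewrite scaler1 scalerDl addrCA.
split=> -[d1 d2]; split.
- by rewrite /derivable -E.
- by rewrite /derive -E.
- by rewrite /derivable E.
- by rewrite /derive E.
Qed.

Definition mix x y k : 'rV[R]_n := \row_i (if (i < k)%N then y 0 i else x 0 i).

Lemma mix0 x y : mix x y 0 = x.
Proof. by apply/rowP => i; rewrite mxE. Qed.

Lemma mixn x y : mix x y n = y.
Proof. by apply/rowP => i; rewrite mxE ltn_ord. Qed.

Lemma mixS x y (k : 'I_n) :
  mix x y k.+1 = mix x y k + (y 0 k - x 0 k) *: 'e_k.
Proof.
apply/rowP => i; rewrite !mxE eqxx /= ltnS leq_eqVlt.
have [ik|ik] := eqVneq i k; first by rewrite ik eqxx ltnn/= mulr1 addrCA subrr addr0.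
rewrite (negbTE (_ : nat_of_ord i != k))//= mulr0 addr0.
by rewrite /leq; case: ifP.
Qed.

Lemma mx_norm_le x (e : R) : 0 <= e ->
  (forall i, `|x 0 i| <= e) -> `|x| <= e.
Proof.
move=> e0 h; rewrite [leLHS]/Num.Def.normr/= mx_normrE bigmax_le//= => -[i j] _.
by rewrite ord1.
Qed.

Lemma coord_le_norm x i : `|x 0 i| <= `|x|.
Proof.
rewrite [leRHS]/Num.Def.normr/= mx_normrE.
exact: le_trans (le_bigmax _ _ (0, i)).
Qed.

(* Mean value theorem on one edge of the staircase path from x to y. *)
Lemma mix_MVT f (df : 'I_n -> 'rV[R]_n -> R) x y (k : 'I_n) :
  (forall z, `|z - x| <= `|y - x| ->
     is_derive z 'e_k f (df k z)) ->
  exists2 z, `|z - x| <= `|y - x| &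
    f (mix x y k.+1) - f (mix x y k) = (y 0 k - x 0 k) * df k z.
Proof.
move=> dfP; set c := y 0 k - x 0 k.
pose w t := mix x y k + (c * t) *: 'e_k.
have wb (t : R) : 0 <= t <= 1 -> `|w t - x| <= `|y - x|.
  move=> /andP[t0 t1]; apply: mx_norm_le => // i.
  rewrite !mxE eqxx/=; have := coord_le_norm (y - x) i; rewrite !mxE.
  have [->|ik] := eqVneq i k.
    rewrite ltnn/= mulr1 -/c addrAC subrr add0r.
    rewrite normrM (ger0_norm t0) => h; apply: le_trans h.
    by rewrite -[leRHS]mulr1 ler_wpM2l.
  rewrite mulr0 addr0; case: ifP => // _ _.
  by rewrite subrr normr0.
have gd (t : R) : 0 <= t <= 1 -> is_derive t 1 (fun t => f (w t)) (c * df k (w t)).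
  move=> t01; have /is_derive_line h := dfP _ (wb _ t01).
  have h2 : is_derive t 1 (fun t : R => c * t) c.
    apply: is_derive_eq; by rewrite /GRing.scale/= mulr1.
  have := is_derive1_comp h h2.
  by rewrite mulrC; apply.
have [|||t t01] := @MVT_segment R (fun t => f (w t)) (fun t => c * df k (w t)) 0 1.
- exact: ler01.
- by move=> t; rewrite in_itv/= => /andP[a b]; apply: gd; rewrite !ltW.
- apply: derivable_within_continuous => t; rewrite in_itv/= => h.
  by have [] := gd _ h.
- rewrite subr0 mulr1 => E; exists (w t).
    by apply: wb; rewrite in_itv in t01.
  rewrite -E /w mulr1 mulr0 scale0r addr0 mixS//.
Qed.

(** Chain rule from continuous partial derivatives alone. The increment of [f] is telescoped along
    the staircase from [c s] to [c (h + s)]; on each edge the mean value theorem gives a partial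
    derivative at a point that tends to [c s]. *)
Lemma is_derive_comp_curve f (df : 'I_n -> 'rV[R]_n -> R)
    (c : R -> 'rV[R]_n) (dc : 'I_n -> R) (s : R) :
  (\forall y \near c s, forall i, is_derive y 'e_i f (df i y)) ->
  (forall i, {for c s, continuous (df i)}) ->
  (forall i, is_derive s 1 (fun t => c t 0 i) (dc i)) ->
  is_derive s 1 (f \o c) (\sum_i dc i * df i (c s)).
Proof.
move=> /nbhs_normP[e/= e0 dfP] dfc cP.
have dcP : derivable c s 1.
  by apply/derivable_mxP => i j; rewrite (ord1 i); have [] := cP j.
have cc : {for s, continuous c}.
  by apply: differentiable_continuous; apply/derivable1_diffP.
(* The condition on [y] sits under the existential, so that the choice function [xi] is total. *)
have ex y (k : 'I_n) : exists z, `|y - c s| < e -> `|z - c s| <= `|y - c s| /\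
    f (mix (c s) y k.+1) - f (mix (c s) y k) = (y 0 k - c s 0 k) * df k z.
  have [ye|ye] := ltP `|y - c s| e; last by exists 0.
  have [z zP|z z1 z2] := @mix_MVT f df (c s) y k.
    by apply: dfP; rewrite /= distrC; exact: le_lt_trans ye.
  by exists z.
pose xi y (k : 'I_n) := projT1 (cid (ex y k)).
have xiP y (k : 'I_n) : `|y - c s| < e -> `|xi y k - c s| <= `|y - c s| /\
    f (mix (c s) y k.+1) - f (mix (c s) y k) = (y 0 k - c s 0 k) * df k (xi y k).
  by rewrite /xi; case: cid.
have chs : (fun h : R => c (h + s)) @ 0^' --> c s.
  have : (fun h : R => c (h + s)) @ 0 --> c (0 + s).
    apply: (@cvg_comp _ _ _ (fun h : R => h + s) c _ (nbhs (0 + s))).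
      by apply: cvgD; [exact: cvg_id|exact: cvg_cst].
    by rewrite add0r; exact: cc.
  rewrite add0r; apply: cvg_trans; apply: cvg_app; exact: cvg_within.
have xic (k : 'I_n) : (fun h : R => xi (c (h + s)) k) @ 0^' --> c s.
  apply/cvgrPdist_lt => r r0.
  near=> h.
  have h1 : `|c (h + s) - c s| < Num.min e r.
    near: h; rewrite /=.
    have : 0 < Num.min e r by rewrite lt_min e0.
    by move/cvgrPdist_lt : chs => /[apply]; apply: filterS => h; rewrite distrC.
  move: h1; rewrite lt_min => /andP[/(xiP _ k)[h1 _] h2].
  by rewrite distrC (le_lt_trans h1).
have key : h^-1 *: ((f \o c) (h *: 1 + s) - (f \o c) s) @[h --> 0^'] -->
    \sum_i dc i * df i (c s).
  have H : (fun h : R => \sum_i (h^-1 *: (c (h *: 1 + s) 0 i - c s 0 i)) *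
      df i (xi (c (h + s)) i)) @ 0^' --> \sum_i dc i * df i (c s).
    apply: cvg_sumr => i.
    have A : h^-1 *: (c (h *: 1 + s) 0 i - c s 0 i) @[h --> 0^'] --> dc i.
      by have [d1 <-] := cP i; exact: d1.
    exact: cvgM A (cvg_comp _ _ (xic i) (dfc i)).
  apply: cvg_trans H; apply: near_eq_cvg; near=> h.
  rewrite /= scaler1.
  have h1 : `|c (h + s) - c s| < e.
    near: h; rewrite /=.
    by move/cvgrPdist_lt : chs => /(_ _ e0); apply: filterS => h; rewrite distrC.
  have -> : f (c (h + s)) - f (c s) =
      \sum_(i < n) (f (mix (c s) (c (h + s)) i.+1) - f (mix (c s) (c (h + s)) i)).
    rewrite -(big_mkord xpredT (fun k => f (mix _ _ k.+1) - f (mix _ _ k))).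
    by rewrite (telescope_sumr (fun k => f (mix (c s) (c (h + s)) k)))// mixn mix0.
  rewrite scaler_sumr.
  apply: eq_bigr => i _; have [_ ->] := xiP _ i h1.
  by rewrite /GRing.scale/= mulrA.
split; first by apply/cvg_ex; eexists; exact: key.
exact/cvg_lim.
Unshelve. all: by end_near. Qed.

End chain_rule.

(** * Measurability and integration by parts on R^n *)

Section continuous_measurable.
Context {R : realType} {n : nat}.

Definition grid (k : nat) (m : 'rV[int]_n) : 'rV[R]_n :=
  \row_i ((m 0 i)%:~R / k.+1%:R).

Definition gridpoint (k : nat) (x : 'rV[R]_n) : 'rV[int]_n :=
  \row_i Num.floor (x 0 i * k.+1%:R).

Lemma gridpoint_dist k x : `|grid k (gridpoint k x) - x| <= k.+1%:R^-1.
Proof.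
apply: mx_norm_le => // i; rewrite !mxE.
have k0 : (0 : R) < k.+1%:R by [].
have /andP[] := floor_itv (x 0 i * k.+1%:R).
rewrite intrD -ler_pdivrMr// => h1; rewrite -ltr_pdivlMr// mulrDl => h2.
by rewrite distrC ger0_norm ?subr_ge0// lerBlDl ltW//; move: h2; rewrite div1r.
Qed.

Lemma measurable_gridpoint k (m : 'rV[int]_n) :
  measurable [set x : 'rV[R]_n | gridpoint k x = m].
Proof.
have -> : [set x : 'rV[R]_n | gridpoint k x = m] =
    \bigcap_(i in [set: 'I_n]) ((fun x : 'rV[R]_n => x 0 i) @^-1`
      ((fun t => t * k.+1%:R) @^-1` `[(m 0 i)%:~R, (m 0 i + 1)%:~R[)).
  apply/seteqP; split => [x <- i _|x h]/=.
    by rewrite in_itv/= mxE floor_itv.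
  by apply/rowP => i; rewrite mxE; apply: floor_def; have := h i I; rewrite /= in_itv.
apply: fin_bigcap_measurable; first exact: finite_finset.
move=> i _; rewrite -[X in measurable X]setTI; apply: measurable_coord => //.
rewrite -[X in measurable X]setTI; apply: measurable_funM => //.
Qed.

(** The composition is constant on each of countably many measurable cells, hence measurable
    whatever [f] is. *)
Lemma measurable_grid_comp k (f : 'rV[R]_n -> R) :
  measurable_fun setT (fun x => f (grid k (gridpoint k x))).
Proof.
move=> _ Y mY; rewrite setTI.
have -> : (fun x => f (grid k (gridpoint k x))) @^-1` Y =
   \bigcup_m (if f (grid k m) \in Y then [set x | gridpoint k x = m] else set0).
  apply/seteqP; split => [x /= fY|x [m _]].
    by exists (gridpoint k x) => //; rewrite mem_set.
  by case: ifPn => // /set_mem h /= ->.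
apply: countable_bigcupT_measurable => [|m]; first exact: countableP.
by case: ifP => _ //; exact: measurable_gridpoint.
Qed.

(* f is the pointwise limit of its compositions with rounding to finer grids. *)
Lemma continuous_measurable_rV (D : set 'rV[R]_n) (f : 'rV[R]_n -> R) :
  {in D, continuous f} -> measurable_fun D f.
Proof.
move=> fc; apply: (@measurable_fun_cvg _ _ _ _
  (fun k x => f (grid k (gridpoint k x)))) => [k|x Dx].
  by apply: measurable_funTS; exact: measurable_grid_comp.
have : (fun k => grid k (gridpoint k x)) @ \oo --> x.
  apply/cvgrPdist_le => e e0; near=> k.
  rewrite distrC; apply: le_trans (gridpoint_dist _ _) _; rewrite ltW//.
  by near: k; exact: (near_infty_natSinv_lt (PosNum e0)).
by move/cvg_comp; apply; apply: fc; rewrite inE.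
Unshelve. all: by end_near. Qed.

End continuous_measurable.

Section topology_integration.
Context {R : realType}.

Lemma cvg_rV n T (F : set_system T) (f : T -> 'rV[R]_n) (l : 'rV[R]_n) :
  Filter F -> (forall i, f t 0 i @[t --> F] --> l 0 i) -> f @ F --> l.
Proof.
move=> FF fl; apply/cvgrPdist_le => e e0; near=> t.
apply: mx_norm_le; first exact: ltW.
near: t; apply: filter_forall => i.
move/cvgrPdist_le : (fl i) => /(_ _ e0); apply: filterS => t.
by rewrite !mxE.
Unshelve. all: by end_near. Qed.

Lemma compact_continuous_bound (T : topologicalType) (A : set T) (f : T -> R) :
  compact A -> {within A, continuous f} ->
  exists2 C, 0 <= C & forall x, A x -> `|f x| <= C.
Proof.
move=> cA cf; have [C [_ /(_ (`|C| + 1))]] := compact_bounded (continuous_compact cf cA).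
have -> : C < `|C| + 1 by rewrite (le_lt_trans (ler_norm _))// ltrDl.
move=> /(_ isT) h; exists (`|C| + 1); first by rewrite addr_ge0.
by move=> x Ax; apply: h; exists x.
Qed.

Lemma bounded_support_integrable d (T : measurableType d)
    (mu : {measure set T -> \bar R}) (D : set T) (f : T -> R) (C : R) :
  measurable D -> (mu D < +oo)%E -> measurable_fun setT f ->
  (forall x, `|f x| <= C) -> (forall x, ~ D x -> f x = 0) ->
  mu.-integrable setT (EFin \o f).
Proof.
move=> mD muD mf fC f0.
have : mu.-integrable D (EFin \o f).
  apply: measurable_bounded_integrable => //; first exact: measurable_funTS.
  exists C; split; first exact: num_real.
  by move=> M CM x _ /=; rewrite (le_trans (fC x))// ltW.
move/(integrable_mkcond _ mD).1; congr (integrable _ _ _); apply/funext => x.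
rewrite /patch; case: ifPn => // xD /=; rewrite f0// => /mem_set.
by rewrite (negbTE xD).
Qed.

End topology_integration.

Section box.
Context {R : realType}.

(** A compact set containing the unit ball. A cube is chosen because its preimage under [rV_cons] is
    a product, so that its volume is seen to be finite by induction on the dimension. *)
Definition box n : set 'rV[R]_n := [set x | forall i, -1 <= x 0 i <= 1].

Lemma measurable_box n : measurable (@box n).
Proof.
have -> : @box n = \bigcap_(i in [set: 'I_n]) ((fun x : 'rV[R]_n => x 0 i) @^-1` `[-1, 1]).
  apply/seteqP; split => [x h i _|x h i]/=; first by rewrite in_itv/=.
  by have := h i I; rewrite /= in_itv.
apply: fin_bigcap_measurable; first exact: finite_finset.
by move=> i _; rewrite -[X in measurable X]setTI; exact: measurable_coord.
Qed.

Lemma compact_box n : compact (@box n).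
Proof.
have := @rV_compact R n (fun=> `[-1, 1]%classic).
have -> : [set v : 'rV[R]_n | forall i : 'I_n, `[-1, 1]%classic (v ord0 i)] = box (n := n).
  by apply/seteqP; split => x h i; have := h i; rewrite /= in_itv.
by apply => _; exact: segment_compact.
Qed.

Lemma preimage_rV_cons_box n :
  @rV_cons R n @^-1` @box n.+1 = `[-1, 1] `*` @box n.
Proof.
apply/seteqP; split => [[t y] h|[t y] [/= ht hy] i]; last first.
  by rewrite rV_consE; case: unliftP => [j|] _ //=; move: ht; rewrite in_itv.
split => /=; first by have := h ord0; rewrite rV_consE unlift_none/= in_itv.
by move=> i; have := h (lift ord0 i); rewrite rV_consE liftK.
Qed.

Lemma lebesgue_itv_fin : lebesgue_measure (`[-1, 1]%classic : set R) \is a fin_num.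
Proof. by rewrite lebesgue_measure_itv/=; case: ifP. Qed.

Lemma lebesgue_rV_box n : (lebesgue_rV n (@box n) < +oo)%E.
Proof.
elim: n => [|n ih].
  rewrite /= /dirac/= indicE; case: (_ \in _); exact: ltry.
rewrite /= /lebesgue_rV_step /pushforward preimage_rV_cons_box.
rewrite product_measure1E//; last exact: measurable_box.
by apply: lte_mul_pinfty => //; exact: lebesgue_itv_fin.
Qed.

Lemma continuous_box_bound n (f : 'rV[R]_n -> R) : continuous f ->
  (forall x, ~ box x -> f x = 0) -> exists2 C, 0 <= C & forall x, `|f x| <= C.
Proof.
move=> cf f0.
have [C C0 h] := compact_continuous_bound (@compact_box n) (continuous_subspaceT cf).
exists C => // x; have [/h//|/f0 ->] := pselect (box x).
by rewrite normr0.
Qed.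

Lemma continuous_box_integrable n (f : 'rV[R]_n -> R) : continuous f ->
  (forall x, ~ box x -> f x = 0) ->
  (lebesgue_rV n).-integrable setT (EFin \o f).
Proof.
move=> cf f0; have [C C0 h] := continuous_box_bound cf f0.
apply: (bounded_support_integrable (@measurable_box n)) h f0.
  exact: lebesgue_rV_box.
by apply: continuous_measurable_rV => x _; exact: cf.
Qed.

Lemma continuous_rV_consl n (y : 'rV[R]_n) : continuous (fun t => rV_cons (t, y)).
Proof.
move=> t; apply: cvg_rV => i.
under eq_fun do rewrite rV_consE; rewrite rV_consE.
by case: unliftP => [j|] _; [exact: cvg_cst|exact: cvg_id].
Qed.

Lemma continuous_rV_consr n (t : R) : continuous (fun y : 'rV[R]_n => rV_cons (t, y)).
Proof.
move=> y; apply: (@cvg_rV _ _ _ (nbhs y)) => i.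
under eq_fun do rewrite rV_consE; rewrite rV_consE.
case: unliftP => [j|] _; [exact: (@coord_continuous R 1 n 0 j y)|exact: cvg_cst].
Qed.

Lemma rV_cons_line0 n (t : R) (y : 'rV[R]_n) :
  rV_cons (t, y) = rV_cons (0, y) + t *: 'e_ord0.
Proof.
apply/rowP => i; rewrite rV_consE mxE rV_consE !mxE eqxx/=.
case: unliftP => [j|] -> /=.
  by rewrite mulr0 addr0.
by rewrite mulr1 add0r.
Qed.

Lemma rV_cons_lineS n (t s : R) (y : 'rV[R]_n) j :
  rV_cons (t, y + s *: 'e_j) = rV_cons (t, y) + s *: 'e_(lift ord0 j).
Proof.
apply/rowP => i; rewrite rV_consE mxE rV_consE !mxE eqxx/=.
case: unliftP => [k|] -> /=.
  by rewrite !mxE eqxx/= (inj_eq lift_inj).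
by rewrite mulr0 addr0.
Qed.

Lemma integral_pderiv_line (g dg : R -> R) :
  (forall t : R, is_derive t 1 g (dg t)) -> continuous dg ->
  (forall t, ~ `[-1, 1]%classic t -> g t = 0) ->
  (forall t, ~ `[-1, 1]%classic t -> dg t = 0) ->
  (\int[lebesgue_measure]_t (dg t)%:E = 0)%E.
Proof.
move=> gP cdg g0 dg0.
have cg : continuous g.
  move=> t; apply: differentiable_continuous; apply/derivable1_diffP.
  by have [] := gP t.
(* The interval is widened so that its endpoints lie where [g] is assumed to vanish; nothing is
   assumed of [g] at -1 and 1. *)
have -> : (\int[lebesgue_measure]_t (dg t)%:E =
    \int[lebesgue_measure]_(t in `[(-2)%R, 2%R]) (dg t)%:E)%E.
  rewrite [RHS]integral_mkcond; apply: eq_integral => t _.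
  rewrite /patch; case: ifPn => // /negP tD; rewrite dg0// => /= t1; apply: tD.
  by apply/mem_set; move: t1 => /=; rewrite !in_itv/= => /andP[a b]; lra.
rewrite (@continuous_FTC2 _ dg g); first last.
- by move=> t _; rewrite derive1E; have [] := gP t.
- split.
  + by move=> t _; have [] := gP t.
  + exact/cvg_at_right_filter/cg.
  + exact/cvg_at_left_filter/cg.
- exact: continuous_subspaceT.
- lra.
by rewrite !g0 ?subee//= in_itv/=; lra.
Qed.

(** Fubini with the order of integration adapted to [i]: for the first coordinate the inner integral
    runs along it and vanishes by the fundamental theorem of calculus; for another one the first
    coordinate is frozen and the induction hypothesis applies to the inner integral. *)
Lemma integral_pderiv_eq0 n (i : 'I_n) (g dg : 'rV[R]_n -> R) :
  (forall x, is_derive x 'e_i g (dg x)) -> continuous dg ->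
  (forall x, ~ box x -> g x = 0) -> (forall x, ~ box x -> dg x = 0) ->
  (\int[lebesgue_rV n]_x (dg x)%:E = 0)%E.
Proof.
elim: n => [|n ih] in i g dg *; first by case: i.
move=> gP cdg g0 dg0.
have mdg : measurable_fun setT dg.
  by apply: continuous_measurable_rV => x _; exact: cdg.
have [C C0 dgC] := continuous_box_bound cdg dg0.
have mcons := @measurable_rV_cons R n.
have mD : measurable (@rV_cons R n @^-1` @box n.+1).
  by rewrite -[X in measurable X]setTI; apply: mcons => //; exact: measurable_box.
have int : (lebesgue_measure \x lebesgue_rV n)%E.-integrable setT
    (EFin \o dg \o @rV_cons R n).
  refine (@bounded_support_integrable R _ _ (lebesgue_measure \x lebesgue_rV n)%E _
      (dg \o @rV_cons R n) C mD _ _ _ _).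
  - exact: (lebesgue_rV_box n.+1).
  - exact: measurableT_comp.
  - by move=> x; exact: dgC.
  - by move=> x /= /dg0.
have offt (t : R) (y : 'rV[R]_n) : ~ `[-1, 1]%classic t -> ~ box (rV_cons (t, y)).
  move=> ht h; apply: ht.
  by have := h ord0; rewrite rV_consE unlift_none/= in_itv.
have offy (t : R) (y : 'rV[R]_n) : ~ box y -> ~ box (rV_cons (t, y)).
  by move=> hy h; apply: hy => k; have := h (lift ord0 k); rewrite rV_consE liftK.
have -> : (\int[lebesgue_rV n.+1]_x (dg x)%:E =
    \int[lebesgue_measure \x lebesgue_rV n]_z ((EFin \o dg \o @rV_cons R n) z))%E.
  have mEdg : measurable_fun setT (EFin \o dg) by exact/measurable_EFinP.
  have := integral_pushforward _ mEdg int measurableT.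
  by apply; exact: mcons.
case: (unliftP ord0 i) => [j|] ij.
- rewrite -(integral12_prod_meas1 int) -[RHS](integral0 lebesgue_measure setT).
  apply: eq_integral => t _; rewrite /fubini_F/=.
  apply: (ih j (fun y => g (rV_cons (t, y)))).
  + move=> y; have E : rV_cons (t, y) = rV_cons (t, y) + 0 *: 'e_i.
      by rewrite scale0r addr0.
    have := gP (rV_cons (t, y)); rewrite {1}E => /is_derive_line h.
    rewrite -{1}(addr0 y) -(scale0r 'e_j); apply/is_derive_line.
    move: h; congr (is_derive _ _ _ _); apply/funext => s.
    by rewrite ij rV_cons_lineS.
  + move=> y; apply: continuous_comp; first exact: continuous_rV_consr.
    exact: cdg.
  + by move=> y /(offy t); exact: g0.
  + by move=> y /(offy t); exact: dg0.
- rewrite -(integral21_prod_meas1 int) -[RHS](integral0 (lebesgue_rV n) setT).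
  apply: eq_integral => y _; rewrite /fubini_G/=.
  apply: (@integral_pderiv_line (fun t => g (rV_cons (t, y)))).
  + move=> t; have := gP (rV_cons (t, y)); rewrite {1}rV_cons_line0 ij.
    move=> /is_derive_line.
    by congr (is_derive _ _ _ _); apply/funext => s; rewrite -rV_cons_line0.
  + move=> t; apply: continuous_comp; first exact: continuous_rV_consl.
    exact: cdg.
  + by move=> t /(@offt t y); exact: g0.
  + by move=> t /(@offt t y); exact: dg0.
Qed.

End box.

(** * Truncated squares, partial derivatives and radial functions *)

Section one_variable.
Context {R : realType}.

(** The difference quotient at 0 is [f h] itself, so continuity suffices. This settles the point 0
    both for [sqrpos] and for [t *]|t| [^ p]. *)
Lemma is_derive_mul_id0 (f : R -> R) :
  {for 0, continuous f} -> is_derive (0 : R) 1 (fun t => t * f t) (f 0).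
Proof.
move=> fc.
have key : h^-1 *: ((h *: 1 + 0) * f (h *: 1 + 0) - 0 * f 0) @[h --> 0^'] --> f 0.
  have : f h @[h --> 0^'] --> f 0 by apply: cvg_within_filter; exact: fc.
  apply: cvg_trans; apply: near_eq_cvg; near=> h.
  rewrite scaler1 addr0 mul0r subr0 /GRing.scale/= mulKf//.
  by near: h; exact: nbhs_dnbhs_neq.
by split; [apply/cvg_ex; exists (f 0)|exact/cvg_lim].
Unshelve. all: by end_near. Qed.

(** The square of the positive part, which is C^1; the form as a product with [t] fits
    [is_derive_mul_id0]. *)
Definition sqrpos (t : R) := t * Num.max 0 t.

Lemma sqrposE t : sqrpos t = Num.max 0 t ^+ 2.
Proof. by rewrite /sqrpos; case: (leP 0 t) => // _; rewrite mulr0 expr0n. Qed.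

Lemma continuous_max0 : continuous (fun t : R => Num.max 0 t).
Proof. by move=> t; apply: continuous_max; [exact: cst_continuous|exact: cvg_id]. Qed.

Lemma is_derive_sqrpos (t : R) : is_derive t 1 sqrpos (2 * Num.max 0 t).
Proof.
have [t0|t0|->] := ltgtP t 0.
- rewrite mulr0.
  apply: (@near_eq_is_derive _ _ _ (cst 0)).
  near=> s; rewrite /sqrpos max_l ?mulr0//.
  by apply/ltW; near: s; exact: lt_nbhsl.
- apply: (@near_eq_is_derive _ _ _ (fun s : R => s * s)).
    near=> s; rewrite /sqrpos max_r//.
    by apply/ltW; near: s; exact: lt_nbhsr.
  apply: is_derive_eq; rewrite /GRing.scale/=; ring.
- have := @is_derive_mul_id0 (fun t => Num.max 0 t) (@continuous_max0 0).
  by rewrite maxxx mulr0.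
Unshelve. all: by end_near. Qed.

End one_variable.

Section partial_derivatives.
Context {R : realType} {n : nat}.
Implicit Types (x e : 'rV[R]_n) (f : 'rV[R]_n -> R).

(** Unlike in [C1_on], the partial derivatives are data, so that explicit formulas for them can be
    carried through products and compositions. *)
Definition C1_with (D : set 'rV[R]_n) f (df : 'I_n -> 'rV[R]_n -> R) :=
  forall x, D x -> {for x, continuous f} /\
    forall i, is_derive x 'e_i f (df i x) /\ {for x, continuous (df i)}.

Lemma is_derive_line0 f x e (d : R) :
  is_derive x e f d <-> is_derive (0 : R) 1 (fun t => f (x + t *: e)) d.
Proof.
have := @is_derive_line R n f x e 0 d; by rewrite scale0r addr0.
Qed.

Lemma is_derive_comp_rV f (df : 'I_n -> 'rV[R]_n -> R) (D : set 'rV[R]_n)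
    (T : 'rV[R]_n -> 'rV[R]_n) (dT : 'I_n -> R) x e :
  open D -> D (T x) -> C1_with D f df ->
  (forall k, is_derive x e (fun y => T y 0 k) (dT k)) ->
  is_derive x e (f \o T) (\sum_k dT k * df k (T x)).
Proof.
move=> oD DT fP TP; apply/is_derive_line0.
have Tx : T (x + 0 *: e) = T x by rewrite scale0r addr0.
have := @is_derive_comp_curve R n f df (fun t => T (x + t *: e)) dT 0.
rewrite Tx; apply.
- apply: filterS (open_nbhs_nbhs (conj oD DT)) => y /fP[_ h] i.
  by have [] := h i.
- by move=> i; have [_ h] := fP _ DT; have [] := h i.
- by move=> k; apply/is_derive_line0.
Qed.

Lemma is_derive_coord x (i k : 'I_n) :
  is_derive x 'e_i (fun y : 'rV[R]_n => y 0 k) (k == i)%:R.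
Proof.
apply/is_derive_line0.
rewrite (_ : (fun _ => _) = (fun t : R => x 0 k + t * (k == i)%:R)).
  by apply: is_derive_eq; rewrite /GRing.scale/=; ring.
by apply/funext => t; rewrite !mxE eqxx.
Qed.

(** Radial functions are written as functions of the squared norm, which is smooth at the origin. *)
Definition sqnorm x : R := \sum_i x 0 i ^+ 2.

Lemma sqnorm_ge0 x : 0 <= sqnorm x.
Proof. by apply: sumr_ge0 => i _; exact: sqr_ge0. Qed.

Lemma sqnormZ (a : R) x : sqnorm (a *: x) = a ^+ 2 * sqnorm x.
Proof. by rewrite /sqnorm mulr_sumr; apply: eq_bigr => i _; rewrite mxE exprMn. Qed.

Lemma enormE x : enorm x = Num.sqrt (sqnorm x). Proof. by []. Qed.

Lemma enorm_ge0 x : 0 <= enorm x. Proof. exact: sqrtr_ge0. Qed.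

Lemma enorm_sqr x : enorm x ^+ 2 = sqnorm x.
Proof. by rewrite enormE sqr_sqrtr// sqnorm_ge0. Qed.

Lemma enormZ (a : R) x : enorm (a *: x) = `|a| * enorm x.
Proof. by rewrite enormE sqnormZ sqrtrM ?sqr_ge0// sqrtr_sqr. Qed.

Lemma eball_sqnorm x : eball R n x = (sqnorm x < 1) :> Prop.
Proof.
by rewrite /eball/= enormE -[in LHS]sqrtr1 ltr_sqrt.
Qed.

Lemma sqr_coord_le x i : x 0 i ^+ 2 <= sqnorm x.
Proof.
rewrite /sqnorm (bigD1 i)//= lerDl; apply: sumr_ge0 => j _; exact: sqr_ge0.
Qed.

Lemma sqnorm_box x : sqnorm x <= 1 -> box x.
Proof.
move=> h i; rewrite -ler_norml -(@expr_le1 _ 2)//.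
by rewrite real_normK ?num_real// (le_trans (sqr_coord_le _ _)).
Qed.

Lemma continuous_sqnorm : continuous sqnorm.
Proof.
move=> x; apply: (@cvg_sumr _ _ _ _ (nbhs x)) => i.
have h := @coord_continuous R 1 n 0 i x.
under eq_fun do rewrite expr2; rewrite expr2; exact: (cvgM h h).
Qed.

Lemma open_eball : open (eball R n).
Proof.
have -> : eball R n = sqnorm @^-1` [set t | t < 1].
  by apply/seteqP; split => x; rewrite eball_sqnorm.
by apply: open_comp; [move=> x _; exact: continuous_sqnorm|exact: open_lt].
Qed.

Lemma compact_sqnorm_le (s : R) : s <= 1 -> compact [set x | sqnorm x <= s].
Proof.
move=> s1; apply: (subclosed_compact _ (@compact_box R n)).
- by apply: (@closed_comp _ _ sqnorm [set t | t <= s]); [move=> x _; apply: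
    continuous_sqnorm|exact: closed_le].
- by move=> x /= h; apply: sqnorm_box; exact: le_trans h s1.
Qed.

Lemma is_derive_sqnorm x (i : 'I_n) : is_derive x 'e_i sqnorm (2 * x 0 i).
Proof.
have -> : 2 * x 0 i = \sum_k (2 * x 0 k * (k == i)%:R).
  by rewrite (bigD1 i)//= eqxx mulr1 big1 ?addr0// => k /negbTE ->; rewrite mulr0.
apply: is_derive_sumr => k; have h := is_derive_coord x i k.
by apply: is_derive_eq; rewrite /GRing.scale/=; ring.
Qed.

Lemma is_derive_comp_real f (a : R -> R) x e (df da : R) :
  is_derive x e f df -> is_derive (f x) 1 a da ->
  is_derive x e (fun y => a (f y)) (da * df).
Proof.
move=> /is_derive_line0 fP aP; apply/is_derive_line0.
apply: (@is_derive1_comp _ a (fun t : R => f (x + t *: e)) 0).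
by rewrite scale0r addr0.
Qed.

Lemma is_derive_radial (r : R -> R) (dr : R) x (i : 'I_n) :
  is_derive (sqnorm x) 1 r dr ->
  is_derive x 'e_i (fun y => r (sqnorm y)) (2 * x 0 i * dr).
Proof.
by move=> rP; rewrite mulrC; exact: is_derive_comp_real (is_derive_sqnorm x i) rP.
Qed.

End partial_derivatives.

Section continuousMD.
Context {R : realType} {T : topologicalType}.
Implicit Types f g : T -> R.

Lemma continuous_mulr_at f g x : {for x, continuous f} -> {for x, continuous g} ->
  {for x, continuous (fun x => f x * g x)}.
Proof. by move=> cf cg; exact: (cvgM cf cg). Qed.

Lemma continuous_mulr f g : continuous f -> continuous g -> continuous (fun x => f x * g x).
Proof. by move=> cf cg x; exact: (cvgM (cf x) (cg x)). Qed.

Lemma continuous_addr f g : continuous f -> continuous g -> continuous (fun x => f x + g x).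
Proof. by move=> cf cg x; exact: (cvgD (cf x) (cg x)). Qed.

Lemma continuous_const (c : R) : continuous (fun _ : T => c).
Proof. by move=> x; exact: cvg_cst. Qed.

End continuousMD.

(** * Spherical means of rotation derivatives *)

Section rotation_field.
Context {R : realType} {n : nat}.
Variables (F : 'rV[R]_n -> R) (dF : 'I_n -> 'rV[R]_n -> R).
Hypothesis FP : C1_with (eball R n) F dF.
Implicit Types x y : 'rV[R]_n.

Definition angular (i j : 'I_n) y := y 0 j * dF i y - y 0 i * dF j y.

Section radial_cutoff.
Variables eta deta q dq : R -> R.
Hypothesis etaP : forall t : R, 0 <= t -> is_derive t 1 eta (deta t).
Hypothesis detaP : forall t : R, 0 <= t -> {for t, continuous deta}.
Hypothesis qP : forall t : R, 0 <= t -> is_derive t 1 q (dq t).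
Hypothesis dqP : forall t : R, 0 <= t -> {for t, continuous dq}.
Hypothesis q1 : forall t : R, 0 <= t -> q t ^+ 2 * t < 1.
Hypothesis eta0 : forall t : R, 1 <= t -> eta t = 0.
Hypothesis deta0 : forall t : R, 1 <= t -> deta t = 0.

(** [F] is controlled on the open ball only. By [q1] the radial map [T] sends all of R^n into that
    ball, so [F] composed with [T] is C^1 everywhere and integration by parts on R^n applies. *)
Let T x := q (sqnorm x) *: x.

Let eball_T x : eball R n (T x).
Proof. by rewrite eball_sqnorm sqnormZ q1// sqnorm_ge0. Qed.

Let radial_continuous (f : R -> R) : (forall t : R, 0 <= t -> {for t, continuous f}) ->
  continuous (fun x => f (sqnorm x)).
Proof.
move=> cf x; apply: continuous_comp; first exact: continuous_sqnorm.
by apply: cf; exact: sqnorm_ge0.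
Qed.

Let ceta := radial_continuous (fun t t0 => is_derive_continuous (etaP t0)).
Let cdeta := radial_continuous detaP.
Let cq := radial_continuous (fun t t0 => is_derive_continuous (qP t0)).
Let cdq := radial_continuous dqP.

Let ccoord (k : 'I_n) : continuous (fun x : 'rV[R]_n => x 0 k).
Proof. by move=> x; exact: (@coord_continuous R 1 n 0 k x). Qed.

Let cconst (c : R) : continuous (fun _ : 'rV[R]_n => c).
Proof. exact: continuous_const. Qed.

Let cT : continuous T.
Proof.
move=> x; apply: (@cvg_rV _ _ _ (nbhs x)) => i.
under eq_fun do rewrite mxE; rewrite mxE.
by apply: cvgM; [exact: cq|exact: ccoord].
Qed.

Let cFT : continuous (fun x => F (T x)).
Proof.
move=> x; apply: continuous_comp; first exact: cT.
by have [] := FP (eball_T x).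
Qed.

Let cdFT k : continuous (fun x => dF k (T x)).
Proof.
move=> x; apply: continuous_comp; first exact: cT.
by have [_ /(_ k)[]] := FP (eball_T x).
Qed.

(** The derivative of [G j] in direction i minus that of [G i] in direction j is the cut-off
    rotation derivative of [F] at [T x]: the factor [q] from the chain rule turns [x 0 j] into the
    coordinate of [T x]. *)
Let G j x := eta (sqnorm x) * (x 0 j * F (T x)).

Let dG i j x := 2 * x 0 i * deta (sqnorm x) * (x 0 j * F (T x)) +
  eta (sqnorm x) * ((j == i)%:R * F (T x) +
    x 0 j * \sum_k (2 * x 0 i * dq (sqnorm x) * x 0 k + q (sqnorm x) * (k == i)%:R)
              * dF k (T x)).

Let is_derive_G i j x : is_derive x 'e_i (G j) (dG i j x).
Proof.
have h1 := is_derive_radial i (etaP (sqnorm_ge0 x)).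
have hq := is_derive_radial i (qP (sqnorm_ge0 x)).
have h2 k := is_derive_coord x i k.
have h3 : is_derive x 'e_i (F \o T) (\sum_k (2 * x 0 i * dq (sqnorm x) * x 0 k +
    q (sqnorm x) * (k == i)%:R) * dF k (T x)).
  apply: (is_derive_comp_rV (@open_eball R n) (eball_T x) FP) => k.
  rewrite (_ : (fun _ => _) = fun y : 'rV[R]_n => q (sqnorm y) * y 0 k); last first.
    by apply/funext => y; rewrite mxE.
  apply: (is_derive_eq (is_deriveM hq (h2 k))).
  by rewrite /GRing.scale/=; ring.
apply: (is_derive_eq (is_deriveM h1 (is_deriveM (h2 j) h3))).
by rewrite /GRing.scale/= /dG fctE/=; ring.
Qed.

Let cdG i j : continuous (dG i j).
Proof.
have csum : continuous (fun x => \sum_k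
    (2 * x 0 i * dq (sqnorm x) * x 0 k + q (sqnorm x) * (k == i)%:R) * dF k (T x)).
  move=> x; apply: (@cvg_sumr _ _ _ _ (nbhs x)) => k.
  have c1 := continuous_mulr (continuous_mulr (continuous_mulr (@cconst 2) (@ccoord
      i)) cdq) (@ccoord k).
  have c2 := continuous_mulr (continuous_addr c1 (continuous_mulr cq (@cconst (k ==
      i)%:R))) (@cdFT k).
  exact: (c2 x).
have c1 := continuous_mulr (continuous_mulr (continuous_mulr (@cconst 2) (@ccoord
    i)) cdeta) (continuous_mulr (@ccoord j) cFT).
exact: (continuous_addr c1 (continuous_mulr ceta (continuous_addr (continuous_mulr
    (@cconst (j == i)%:R) cFT) (continuous_mulr (@ccoord j) csum)))).
Qed.

Let off_box x : ~ box x -> 1 <= sqnorm x.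
Proof. by move=> bx; rewrite leNgt; apply/negP => /ltW/sqnorm_box. Qed.

Let dG_off i j x : ~ box x -> dG i j x = 0.
Proof. by move=> /off_box h; rewrite /dG eta0// deta0// !(mulr0, mul0r) addr0. Qed.

Let integral_dG i j : (\int[lebesgue_rV n]_x (dG i j x)%:E = 0)%E.
Proof.
apply: (integral_pderiv_eq0 (is_derive_G i j)).
- exact: cdG.
- by move=> x /off_box h; rewrite /G eta0// mul0r.
- by move=> x; exact: dG_off.
Qed.

Lemma continuous_cutoff_angular i j :
  continuous (fun x => eta (sqnorm x) * angular i j (q (sqnorm x) *: x)).
Proof.
apply: (continuous_mulr ceta); rewrite /angular; under eq_fun do rewrite !mxE.
have c k l := continuous_mulr (continuous_mulr cq (@ccoord k)) (@cdFT l).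
by move=> x; exact: (cvgB (c j i x) (c i j x)).
Qed.

(* The derivatives of the radial factors cancel in the antisymmetrised sum. *)
Lemma integral_cutoff_angular i j : i != j ->
  (\int[lebesgue_rV n]_x (eta (sqnorm x) * angular i j (q (sqnorm x) *: x))%:E = 0)%E.
Proof.
move=> ij.
have E x : eta (sqnorm x) * angular i j (T x) = dG i j x - dG j i x.
  rewrite /angular /dG (negbTE ij) eq_sym (negbTE ij) !mul0r !add0r.
  have S m : \sum_k (2 * x 0 m * dq (sqnorm x) * x 0 k + q (sqnorm x) * (k ==
      m)%:R) * dF k (T x)
     = x 0 m * (\sum_k (2 * dq (sqnorm x) * x 0 k * dF k (T x))) + q (sqnorm x) *
         dF m (T x).
    under eq_bigr do rewrite mulrDl; rewrite big_split/=; congr (_ + _).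
      by rewrite mulr_sumr; apply: eq_bigr => k _; ring.
    rewrite (bigD1 m)//= eqxx mulr1 big1 ?addr0// => k /negbTE ->.
    by rewrite mulr0 mul0r.
  rewrite !S /T !mxE; ring.
under eq_integral do rewrite E EFinB.
rewrite integralB//; [by rewrite !integral_dG subee| |];
  by apply: continuous_box_integrable => //; exact: dG_off.
Qed.

End radial_cutoff.

End rotation_field.

(** * Radial cutoffs and the smoothed projection to a sphere *)

Section cutoffs.
Context {R : realType}.
Variables (s : R).
Hypothesis s01 : 0 <= s < 1.

(** At t = |x|^2 this tends to the indicator of the open unit ball. The square makes the derivative
    vanish at t = 1, so the extension by 0 is C^1. *)
Definition cutoff (k : nat) (t : R) := sqrpos (1 - t ^+ k.+1).
Definition dcutoff (k : nat) (t : R) :=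
  2 * Num.max 0 (1 - t ^+ k.+1) * (- (k.+1%:R * t ^+ k)).
(* rad k (|x|^2) x tends to s x / |x|. *)
Definition rad (k : nat) (t : R) := s * (t + k.+1%:R^-1) `^ (- 2^-1).
Definition drad (k : nat) (t : R) :=
  s * (- 2^-1 * (t + k.+1%:R^-1) `^ (- 2^-1 - 1)).

Lemma is_derive_cutoff k (t : R) : is_derive t 1 (cutoff k) (dcutoff k t).
Proof.
have h : is_derive t 1 (fun t : R => 1 - t ^+ k.+1) (- (k.+1%:R * t ^+ k)).
  apply: (is_derive_eq (is_deriveB (is_derive_cst (1 : R) t (1 : R)) (is_deriveXn k.+1 t))).
  by rewrite sub0r.
exact: (is_derive1_comp (is_derive_sqrpos _) h).
Qed.

Lemma continuous_dcutoff k : continuous (dcutoff k).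
Proof.
have c1 : continuous (fun t : R => 1 - t ^+ k.+1).
  by move=> t; apply: cvgB; [exact: cvg_cst|exact: exprn_continuous].
have c2 : continuous (fun t : R => Num.max 0 (1 - t ^+ k.+1)).
  by move=> t; exact: (cvg_comp _ _ (c1 t) (@continuous_max0 R (1 - t ^+ k.+1))).
have c3 : continuous (fun t : R => - (k.+1%:R * t ^+ k)).
  move=> t; apply: cvgN; apply: cvgM; [exact: cvg_cst|exact: exprn_continuous].
have c := continuous_mulr (continuous_mulr (@continuous_const R R 2) c2) c3. exact: c.
Qed.

Let delta_gt0 k (t : R) : 0 <= t -> 0 < t + k.+1%:R^-1.
Proof. by move=> t0; rewrite ltr_wpDl// invr_gt0. Qed.

Lemma is_derive_shift_powR (a d t : R) : 0 < t + d ->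
  is_derive t 1 (fun t : R => (t + d) `^ a) (a * (t + d) `^ (a - 1)).
Proof.
move=> td; have h : is_derive t 1 (fun t : R => t + d) 1.
  apply: (is_derive_eq (is_deriveD (is_derive_id t (1 : R)) (is_derive_cst d t (1 : R)))).
  by rewrite addr0.
have := @is_derive1_comp R (fun t => t `^ a) (fun t : R => t + d) t _ _
  (is_derive1_powR a td) h.
by rewrite mulr1.
Qed.

Lemma is_derive_rad k (t : R) : 0 <= t -> is_derive t 1 (rad k) (drad k t).
Proof.
move=> /(delta_gt0 k) h; have := is_derive_shift_powR (- 2^-1) h.
exact: is_deriveZ.
Qed.

Lemma continuous_drad k (t : R) : 0 <= t -> {for t, continuous (drad k)}.
Proof.
move=> /(delta_gt0 k) h; have [c _] := is_derive_shift_powR (- 2^-1 - 1) h.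
have {}c : {for t, continuous (fun t : R => (t + k.+1%:R^-1) `^ (- 2^-1 - 1))}.
  by apply: differentiable_continuous; exact/derivable1_diffP.
have c1 := continuous_mulr_at (@continuous_const R R s t) (continuous_mulr_at
    (@continuous_const R R (- 2^-1) t) c).
exact: c1.
Qed.

(** The shift by [k.+1%:R^-1] removes the singularity at the origin and only shortens the vector.
    All the points [rad s k (sqnorm x) *: x] therefore stay in the closed ball of radius [s], a
    compact subset of the open unit ball, which gives a bound uniform in [k] for dominated
    convergence. *)
Lemma rad_sqr k (t : R) : 0 <= t -> rad k t ^+ 2 * t <= s ^+ 2.
Proof.
move=> t0; have d0 := delta_gt0 k t0.
rewrite /rad exprMn powRN powR12_sqrt ?(ltW d0)// exprVn sqr_sqrtr ?(ltW d0)//.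
rewrite -mulrA ler_piMr ?sqr_ge0//.
by rewrite mulrC ler_pdivrMr// mul1r lerDl invr_ge0.
Qed.

Lemma rad_sqr_lt1 k (t : R) : 0 <= t -> rad k t ^+ 2 * t < 1.
Proof.
move=> t0; apply: le_lt_trans (rad_sqr k t0) _.
by case/andP : s01 => s0 s1; rewrite expr_lt1.
Qed.

Lemma cutoff_ge1 k (t : R) : 1 <= t -> cutoff k t = 0.
Proof.
move=> t1; rewrite /cutoff /sqrpos max_l ?mulr0// subr_le0.
exact: exprn_ege1.
Qed.

Lemma dcutoff_ge1 k (t : R) : 1 <= t -> dcutoff k t = 0.
Proof.
by move=> t1; rewrite /dcutoff max_l ?mulr0 ?mul0r// subr_le0 exprn_ege1.
Qed.

Lemma cutoff_bound k (t : R) : 0 <= t -> `|cutoff k t| <= 1.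
Proof.
move=> t0; rewrite /cutoff sqrposE normrX expr_le1// ger0_norm ?le_max ?lexx//.
by rewrite ge_max ler01/= gerBl exprn_ge0.
Qed.

Lemma cvg_cutoff (t : R) : 0 <= t < 1 -> cutoff k t @[k --> \oo] --> (1 : R).
Proof.
move=> /andP[t0 t1].
have h : (fun k => t ^+ k.+1) @ \oo --> (0 : R).
  by rewrite (cvg_shiftS (fun k => t ^+ k)); apply: cvg_expr; rewrite ger0_norm.
have h2 : (fun k => 1 - t ^+ k.+1) @ \oo --> (1 : R).
  by rewrite -[X in _ --> X]subr0; apply: cvgB => //; exact: cvg_cst.
have h3 : {for 1, continuous (@sqrpos R)}.
  apply: differentiable_continuous; apply/derivable1_diffP.
  by have [] := is_derive_sqrpos (1 : R).
have -> : (1 : R) = sqrpos 1 by rewrite /sqrpos max_r ?mulr1.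
exact: (cvg_comp _ _ h2 h3).
Qed.

Lemma cvg_rad (t : R) : 0 < t -> rad k t @[k --> \oo] --> s * (Num.sqrt t)^-1.
Proof.
move=> t0; rewrite -powR12_sqrt ?ltW// -powRN.
apply: cvgM; first exact: cvg_cst.
have h : (fun k => t + k.+1%:R^-1) @ \oo --> t.
  rewrite -[X in _ --> X]addr0; apply: cvgD; first exact: cvg_cst.
  exact: cvg_harmonic.
have h2 : {for t, continuous (fun t : R => t `^ (- 2^-1))}.
  apply: differentiable_continuous; apply/derivable1_diffP.
  by have [] := is_derive1_powR (- 2^-1) t0.
exact: (cvg_comp _ _ h h2).
Qed.

End cutoffs.

Section rotation_ball.
Context {R : realType} {n : nat}.
Variables (F : 'rV[R]_n -> R) (dF : 'I_n -> 'rV[R]_n -> R).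
Hypothesis FP : C1_with (eball R n) F dF.
Variable s : R.
Hypothesis s01 : 0 <= s < 1.
Implicit Types x y : 'rV[R]_n.

Lemma angular_continuous i j y : eball R n y -> {for y, continuous (angular dF i j)}.
Proof.
move=> /FP[_ h]; have [_ hi] := h i; have [_ hj] := h j.
have ci := @coord_continuous R 1 n 0 i y.
have cj := @coord_continuous R 1 n 0 j y.
exact: (cvgB (cvgM cj hi) (cvgM ci hj)).
Qed.

(** The integrand is the rotation derivative on the sphere of radius [s], extended constantly along
    rays: this is the shape that the cone definition of [sphere_measure] calls for. It is the
    dominated limit of cut-off rotation derivatives with integral zero. *)
Lemma integral_angular_ball i j : i != j ->
  (\int[lebesgue_rV n]_x
    (if 0 < enorm x < 1 then angular dF i j (s *: ((enorm x)^-1 *: x)) else 0)%:E = 0)%E.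
Proof.
move=> ij; have /andP[s0 s1] := s01.
have ss1 : s ^+ 2 < 1 by rewrite expr_lt1.
pose f x := if 0 < enorm x < 1
  then angular dF i j (s *: ((enorm x)^-1 *: x)) else 0.
rewrite -/f.
pose f_ k x := cutoff k (sqnorm x) * angular dF i j (rad s k (sqnorm x) *: x).
have cf k : continuous (f_ k).
  apply: (continuous_cutoff_angular FP (eta := cutoff k) (deta := dcutoff k) (q :=
      rad s k) (dq := drad s k)) => t t0.
  - exact: is_derive_cutoff.
  - exact: is_derive_rad.
  - exact: rad_sqr_lt1.
have f0 k : (\int[lebesgue_rV n]_x (f_ k x)%:E = 0)%E.
  apply: (integral_cutoff_angular FP (eta := cutoff k) (deta := dcutoff k) (q :=
      rad s k) (dq := drad s k) _ _ _ _ _ _ _ ij) => t t0.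
  - exact: is_derive_cutoff.
  - exact: continuous_dcutoff.
  - exact: is_derive_rad.
  - exact: continuous_drad.
  - exact: rad_sqr_lt1.
  - exact: cutoff_ge1.
  - exact: dcutoff_ge1.
have [C C0 angC] : exists2 C, 0 <= C &
    forall y, sqnorm y <= s ^+ 2 -> `|angular dF i j y| <= C.
  apply: (@compact_continuous_bound _ _ [set y | sqnorm y <= s ^+ 2]).
    exact/compact_sqnorm_le/ltW.
  apply: continuous_in_subspaceT => y; rewrite inE => hy; apply: angular_continuous.
  by rewrite eball_sqnorm (le_lt_trans hy).
have sq0 x : sqnorm x <= 0 -> forall k, x 0 k = 0.
  move=> h k; apply/eqP; rewrite -sqrf_eq0; apply/eqP/le_anti.
  by rewrite sqr_ge0 (le_trans (sqr_coord_le _ _)).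
(* Three regions: for |x| >= 1 the cutoff is 0; at the origin every [f_ k] is 0, because the
   coefficients of a rotation field vanish there; in between the cutoff tends to 1 and the argument
   to s x / |x|. *)
have cvgf x : f_ k x @[k --> \oo] --> f x.
  have [x1|x1] := leP 1 (sqnorm x).
    rewrite /f ifF; last by rewrite -(expr_lt1 (n := 2))// ?enorm_sqr ?enorm_ge0//
        [X in _ && X]ltNge x1 andbF.
    rewrite (_ : f_^~ x = fun=> 0); first exact: cvg_cst.
    by apply/funext => k; rewrite /f_ cutoff_ge1// mul0r.
  have [x0|x0] := leP (sqnorm x) 0.
    rewrite /f ifF; last by rewrite enormE sqrtr_gt0 ltNge x0.
    rewrite (_ : f_^~ x = fun=> 0); first exact: cvg_cst.
    by apply/funext => k; rewrite /f_ /angular !mxE !(sq0 _ x0) !mulr0 !mul0r subr0 mulr0.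
  rewrite /f ifT; last by rewrite -(expr_lt1 (n := 2))// ?enorm_sqr ?enorm_ge0// x1
      enormE sqrtr_gt0 x0.
  rewrite -[X in _ --> X]mul1r; apply: cvgM.
    by apply: cvg_cutoff; rewrite sqnorm_ge0.
  rewrite scalerA enormE.
  have h : (fun k => rad s k (sqnorm x) *: x) @ \oo --> (s / Num.sqrt (sqnorm x)) *: x.
    by apply: cvgZl; exact: cvg_rad.
  apply: (cvg_comp _ _ h); apply: angular_continuous.
  rewrite eball_sqnorm sqnormZ exprMn exprVn sqr_sqrtr ?sqnorm_ge0//.
  by rewrite -mulrA mulVf ?mulr1// gt_eqF.
have mf_ k : measurable_fun setT (EFin \o f_ k).
  by apply/measurable_EFinP; apply: continuous_measurable_rV => x _; exact: cf.
have cvgEf x : EFin (f_ k x) @[k --> \oo] --> (f x)%:E.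
  by apply: cvg_EFin; [exact: nearW|exact: cvgf].
have mf : measurable_fun setT (EFin \o f).
  by apply: (emeasurable_fun_cvg (fun k => EFin \o f_ k)) => // x _; exact: cvgEf.
have ig : (lebesgue_rV n).-integrable setT (EFin \o (fun x => C * \1_(@box R n) x)).
  apply: (bounded_support_integrable (C := C) (@measurable_box R n)).
  - exact: lebesgue_rV_box.
  - apply: measurable_funM => //; exact: measurable_indic (@measurable_box R n).
  - move=> x; rewrite indicE; case: (_ \in _) => /=.
      by rewrite mulr1 ger0_norm.
    by rewrite mulr0 normr0.
  - by move=> x bx; rewrite indicE memNset// mulr0.
have fg k x : `|f_ k x| <= C * \1_(@box R n) x.
  rewrite indicE; have [bx|bx] := pselect (box x); last first.
    rewrite memNset// mulr0 /f_ cutoff_ge1 ?mul0r ?normr0//.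
    by rewrite leNgt; apply/negP => /ltW/sqnorm_box.
  rewrite mem_set// mulr1 normrM -[X in _ <= X]mul1r ler_pM//.
    by apply: cutoff_bound; exact: sqnorm_ge0.
  by apply: angC; rewrite sqnormZ rad_sqr// sqnorm_ge0.
have [_ _] := @dominated_convergence _ _ _ (lebesgue_rV n) setT measurableT
  (fun k => EFin \o f_ k) (EFin \o f) _ mf_ mf (aeW _ (fun x _ => cvgEf x)) ig
  (aeW _ (fun x k _ => fg k x)).
under eq_fun do rewrite f0.
move/cvg_lim => <- //; exact: lim_cst.
Qed.

End rotation_ball.

(** * Integrals over the sphere as integrals over the punctured ball *)

Section full_measure_set.
Import HBNNSimple.

(* integral_mean integrates over the whole of R^n a function that need not be
   measurable away from the sphere. *)
Lemma ge0_integral_full_set d (T : measurableType d) (R : realType)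
    (mu : {measure set T -> \bar R}) (S : set T) (f : T -> \bar R) :
  measurable S -> mu (~` S) = 0%E -> (forall x, (0 <= f x)%E) ->
  (\int[mu]_x f x = \int[mu]_(x in S) f x)%E.
Proof.
move=> mS S0 f0; apply/le_anti/andP; split; last first.
  rewrite [leLHS]integral_mkcond !ge0_integralE//; last first.
    by move=> x _; rewrite /patch; case: ifPn.
  rewrite !patch_setT; apply: le_ereal_sup => _ [h hf <-]; exists h => // x.
  by apply: le_trans (hf x) _; rewrite /patch; case: ifPn.
rewrite [leRHS]integral_mkcond !ge0_integralE//; last first.
  by move=> x _; rewrite /patch; case: ifPn.
rewrite !patch_setT; apply: ge_ereal_sup => _ [h hf <-].
apply: ereal_sup_ubound; exists (proj_nnsfun h mS) => [x|].
  rewrite /= /patch mindicE; case: ifPn => xS /=; first by rewrite mulr1 hf.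
  by rewrite mulr0.
rewrite -!integralT_nnsfun.
have E (g : {nnsfun T >-> R}) : (\int[mu]_x (g x)%:E = \int[mu]_(x in S) (g x)%:E)%E.
  rewrite (@ge0_negligible_integral _ _ _ mu setT (~` S))//.
  - by rewrite setTD setCK.
  - exact: measurableC.
  - by apply/measurable_EFinP.
  - by move=> x _; rewrite lee_fin.
rewrite !E; apply: eq_integral => x; rewrite inE /= => Sx.
by rewrite mindicE mem_set// mulr1.
Qed.

End full_measure_set.

Section unit_sphere.
Context {R : realType} {n : nat}.
Implicit Types x z : 'rV[R]_n.

Definition usphere : set 'rV[R]_n := [set z | enorm z = 1].
Definition pball : set 'rV[R]_n := [set x | 0 < enorm x < 1].

Lemma measurable_usphere : measurable usphere.
Proof.
rewrite (_ : usphere = @enorm R n @^-1` [set 1])//.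
by rewrite -[X in measurable X]setTI; apply: measurable_enorm.
Qed.

Lemma measurable_pball : measurable pball.
Proof.
rewrite (_ : pball = @enorm R n @^-1` `]0, 1[); last first.
  by apply/seteqP; split => x /=; rewrite in_itv.
by rewrite -[X in measurable X]setTI; apply: measurable_enorm.
Qed.

Lemma enorm_unit x : 0 < enorm x -> enorm ((enorm x)^-1 *: x) = 1.
Proof. by move=> x0; rewrite enormZ ger0_norm ?invr_ge0 ?ltW// mulVf// gt_eqF. Qed.

Lemma sphere_measure_off : sphere_measure R n (~` usphere) = 0%E.
Proof.
rewrite /sphere_measure/= (_ : cone _ = set0) ?measure0 ?mule0//.
by apply/seteqP; split => // x [/andP[x0 _]]/=; apply; exact: enorm_unit.
Qed.

Lemma sphere_measure_le1 : (sphere_measure R n setT <= 1)%E.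
Proof.
rewrite /sphere_measure/=; set V := lebesgue_rV n (eball R n).
have le : (lebesgue_rV n (cone setT) <= V)%E.
  apply: le_measure; rewrite ?inE.
  - exact: measurable_cone.
  - exact: measurable_eball.
  - by move=> x [/andP[]].
have V0 : (0 <= V)%E by exact: measure_ge0.
apply: (@le_trans _ _ ((fine V)^-1%:E * V)%E).
  by rewrite lee_wpmul2l// lee_fin invr_ge0 fine_ge0.
(* If the volume were infinite, [fine] would give 0 and [0^-1 = 0] would make the product 0; it is
   also 0 for volume 0. *)
move: V V0 {le} => [v| |]//= v0; last by rewrite invr0 mul0e.
have [->|vn0] := eqVneq v 0; first by rewrite mule0.
by rewrite -EFinM mulVf.
Qed.

Lemma sphere_measure_fin (A : set 'rV[R]_n) : measurable A ->
  (sphere_measure R n A < +oo)%E.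
Proof.
move=> mA; apply: (@le_lt_trans _ _ 1%E); last exact: ltry.
by apply: le_trans sphere_measure_le1; apply: le_measure; rewrite ?inE.
Qed.

(* The value 0 outside the punctured ball is not on the sphere. *)
Definition sproj x : 'rV[R]_n := \1_pball x *: ((enorm x)^-1 *: x).

Lemma sprojE x : pball x -> sproj x = (enorm x)^-1 *: x.
Proof. by move=> bx; rewrite /sproj indicE mem_set// scale1r. Qed.

Lemma measurable_sproj : measurable_fun [set: 'rV[R]_n] sproj.
Proof.
apply/measurable_fun_rVP => i; under eq_fun do rewrite mxE.
apply: measurable_funM; first exact: measurable_indic measurable_pball.
by have /measurable_fun_rVP := @measurable_sphere_proj R n; exact.
Qed.

Lemma sproj_usphere x : usphere (sproj x) <-> pball x.
Proof.
split=> [|bx]; last by rewrite sprojE//; case/andP : bx => x0 _; exact: enorm_unit.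
have [//|bx] := pselect (pball x).
rewrite /usphere/= /sproj indicE memNset// scale0r => h.
have : enorm (0 : 'rV[R]_n) = 0.
  by rewrite enormE /sqnorm big1 ?sqrtr0// => i _; rewrite mxE expr0n.
by rewrite h => /eqP; rewrite oner_eq0.
Qed.

Let c := (fine (lebesgue_rV n (eball R n)))^-1.

Let c_ge0 : 0 <= c.
Proof. by rewrite invr_ge0 fine_ge0. Qed.

Let image_measure : {measure set 'rV[R]_n -> \bar R}.
Proof. refine (pushforward (lebesgue_rV n) sproj); exact: measurable_sproj. Defined.

(** On Borel subsets of the sphere, [sphere_measure] is by its definition [c] times the image of
    Lebesgue measure under [sproj], so this is the change of variables for an image measure and
    involves no Jacobian. *)
Lemma ge0_integral_usphere (f : 'rV[R]_n -> \bar R) : measurable_fun usphere f ->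
  (forall z, 0 <= f z)%E ->
  (\int[sphere_measure R n]_(z in usphere) f z =
   c%:E * \int[lebesgue_rV n]_(x in pball) f ((enorm x)^-1 *: x)%R)%E.
Proof.
move=> mf f0.
pose m := mscale (NngNum c_ge0) image_measure.
rewrite (@eq_measure_integral _ _ _ _ m); last first.
  move=> A mA AS; rewrite /= /sphere_measure /m /mscale/= /pushforward.
  congr (_ * lebesgue_rV n _)%E; apply/seteqP; split => [x [bx Ax]|x /= Ax].
    by rewrite /= sprojE.
  have /sproj_usphere bx := AS _ Ax.
  by split => //; move: Ax; rewrite sprojE.
rewrite ge0_integral_mscale//; last exact: measurable_usphere.
rewrite ge0_integral_pushforward//; [|exact: measurable_sproj|exact: measurable_usphere].
congr (_ * _)%E; rewrite (_ : sproj @^-1` usphere = pball); last first.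
  by apply/seteqP; split => x /sproj_usphere.
by apply: eq_integral => x; rewrite inE => bx /=; rewrite sprojE.
Qed.

Lemma integral_usphere_eq0 (f : 'rV[R]_n -> R) : measurable_fun usphere f ->
  (\int[lebesgue_rV n]_x
     (if (0 < enorm x < 1)%R then f ((enorm x)^-1 *: x)%R else 0%R)%:E = 0)%E ->
  (\int[sphere_measure R n]_(z in usphere) (f z)%:E = 0)%E.
Proof.
move=> mf /esym h; have mEf : measurable_fun usphere (EFin \o f) by exact/measurable_EFinP.
rewrite integralE !ge0_integral_usphere//; [|exact: measurable_funeneg|exact:
    measurable_funepos].
set A := integral _ _ _; set B := integral _ _ _.
have {h} : (A - B = 0)%E.
  have <- : (\int[lebesgue_rV n]_(x in pball) (f ((enorm x)^-1 *: x))%:E = A - B)%E.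
    by rewrite integralE; congr (_ - _)%E; apply: eq_integral => x _; rewrite
        ?funeposE ?funenegE.
  rewrite h.
  rewrite integral_mkcond; apply: eq_integral => x _; rewrite /patch.
  case: ifPn => [|/negP]; rewrite inE /pball/= => bx; first by rewrite bx.
  by rewrite ifF//; apply/negbTE/negP.
have A0 : (0 <= A)%E by apply: integral_ge0.
have B0 : (0 <= B)%E by apply: integral_ge0.
(* The equation [A - B = 0] leaves only finite values, since [+oo - +oo] is [-oo] by convention. *)
case: A A0 => [a| |]; case: B B0 => [b| |]//= b0 a0.
rewrite -EFinB => -[/eqP]; rewrite subr_eq0 => /eqP ->.
by rewrite -!EFinM -EFinB subrr.
Qed.

End unit_sphere.

Lemma Rintegral_sumr d (T : measurableType d) (R : realType)
    (mu : {measure set T -> \bar R}) (D : set T) I (r : seq I) (f : I -> T -> R) :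
  measurable D -> (forall i, mu.-integrable D (EFin \o f i)) ->
  \int[mu]_(x in D) (\sum_(i <- r) f i x) = \sum_(i <- r) \int[mu]_(x in D) f i x.
Proof.
move=> mD intf; elim: r => [|i r ih].
  by under eq_Rintegral do rewrite big_nil; rewrite big_nil Rintegral_cst// mul0r.
under eq_Rintegral do rewrite big_cons; rewrite big_cons -ih RintegralD//.
rewrite (_ : EFin \o _ = (fun x => \sum_(j <- r) (f j x)%:E)%E).
  by apply: integrable_sum => // j _; exact: intf.
by apply/funext => x; rewrite /= sumEFin.
Qed.

(** * Differentiation of spherical means *)

Section sphere_means.
Context {R : realType} {n : nat}.
Local Notation sigma := (sphere_measure R n).
Local Notation S := (@usphere R n).
Implicit Types (z : 'rV[R]_n) (s : R).

Lemma usphere_sqnorm z : S z -> sqnorm z = 1.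
Proof. by rewrite /usphere/= -enorm_sqr => ->; rewrite expr1n. Qed.

Lemma usphere_coord z i : S z -> `|z 0 i| <= 1.
Proof.
move=> /usphere_sqnorm h; rewrite ler_norml.
by apply: (@sqnorm_box R n z); rewrite h.
Qed.

Lemma usphere_eball z s : -1 < s < 1 -> S z -> eball R n (s *: z).
Proof.
move=> s1 /usphere_sqnorm h; rewrite eball_sqnorm sqnormZ h mulr1.
by rewrite -real_normK ?num_real// expr_lt1// ltr_norml.
Qed.

Lemma compact_usphere : compact S.
Proof.
apply: (subclosed_compact _ (@compact_box R n)).
- rewrite (_ : S = sqnorm @^-1` [set 1]); last first.
    apply/seteqP; split => z /=; first exact: usphere_sqnorm.
    by rewrite /usphere/= enormE => ->; rewrite sqrtr1.
  by apply: (@closed_comp _ _ sqnorm); [move=> x _; exact: continuous_sqnorm|exact: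
      closed_eq].
- by move=> z /usphere_sqnorm h; apply: sqnorm_box; rewrite h.
Qed.

Lemma continuous_usphere_integrable (G : 'rV[R]_n -> R) : {in S, continuous G} ->
  sigma.-integrable S (EFin \o G).
Proof.
move=> cG; have mS := @measurable_usphere R n.
apply: measurable_bounded_integrable => //.
- exact: sphere_measure_fin.
- exact: continuous_measurable_rV.
have [C C0 h] : exists2 C, 0 <= C & forall x, S x -> `|G x| <= C.
  by apply: compact_continuous_bound; [exact: compact_usphere|exact:
      continuous_in_subspaceT].
exists C; split; first exact: num_real.
by move=> M CM z Sz; apply: le_trans (h _ Sz) _; exact: ltW.
Qed.

Lemma continuous_scale_at (F : 'rV[R]_n -> R) s z : {for s *: z, continuous F} ->
  {for z, continuous (fun z => F (s *: z))}.
Proof.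
move=> cF; have h : s *: y @[y --> z] --> s *: z.
  by apply: (@cvgZl_tmp _ _ _ (nbhs z) _ s id); exact: cvg_id.
exact: (cvg_comp _ _ h cF).
Qed.

Section derivative.
Variables (w F : 'rV[R]_n -> R) (dF : 'I_n -> 'rV[R]_n -> R).
Hypothesis cw : continuous w.
Hypothesis w1 : forall z, S z -> `|w z| <= 1.
Hypothesis FP : C1_with (eball R n) F dF.

Lemma integrable_weighted (G : 'rV[R]_n -> R) s :
  (forall y, eball R n y -> {for y, continuous G}) -> -1 < s < 1 ->
  sigma.-integrable S (EFin \o (fun z => w z * G (s *: z))).
Proof.
move=> cG s1; apply: continuous_usphere_integrable => z; rewrite inE => Sz.
apply: (@continuous_mulr_at _ _ w (fun z => G (s *: z))); first exact: cw.
by apply: continuous_scale_at; apply: cG; exact: usphere_eball.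
Qed.

Lemma is_derive_ray s z : -1 < s < 1 -> S z ->
  is_derive s 1 (fun s => F (s *: z)) (\sum_i z 0 i * dF i (s *: z)).
Proof.
move=> s1 Sz; have bsz := usphere_eball s1 Sz.
apply: (@is_derive_comp_curve _ _ F dF (fun s => s *: z) (fun i => z 0 i)) => [|i|i].
- apply: filterS (open_nbhs_nbhs (conj (@open_eball R n) bsz)) => y /FP[_ h] i.
  by have [] := h i.
- by have [_ /(_ i)[]] := FP bsz.
- rewrite (_ : (fun _ => _) = (fun t : R => t * z 0 i)); last first.
    by apply/funext => t; rewrite mxE.
  by apply: is_derive_eq; rewrite /GRing.scale/=; ring.
Qed.

Lemma is_derive_mean s : -1 < s < 1 ->
  is_derive s 1 (fun s => \int[sigma]_(z in S) (w z * F (s *: z)))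
    (\int[sigma]_(z in S) (w z * \sum_i z 0 i * dF i (s *: z))).
Proof.
move=> s1; have [t st /andP[t0 t1]] : exists2 t, `|s| < t & 0 <= t < 1.
  have /midf_lt[st t1] : `|s| < 1 by rewrite ltr_norml.
  by exists ((`|s| + 1) / 2) => //; rewrite t1 andbT (le_trans _ (ltW st)).
have tin x : `](- t), t[%classic x -> -1 < x < 1.
  by rewrite /= in_itv/= -!ltr_norml => /lt_trans; apply.
have [C C0 hC] : exists2 C, 0 <= C & forall y, sqnorm y <= t ^+ 2 ->
    `|\sum_i `|dF i y| | <= C.
  apply: (@compact_continuous_bound _ _ [set y | sqnorm y <= t ^+ 2] (fun y =>
      \sum_i `|dF i y|)).
    by apply: compact_sqnorm_le; rewrite expr_le1// ltW.
  apply: continuous_in_subspaceT => y; rewrite inE => hy.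
  apply: (@cvg_sumr _ _ _ _ (nbhs y)) => i; apply: cvg_norm.
  have [|_ /(_ i)[]//] := FP (x := y).
  by rewrite eball_sqnorm (le_lt_trans hy)// expr_lt1.
have dE x z : `](- t), t[%classic x -> S z ->
    is_derive x 1 (fun x => w z * F (x *: z)) (w z * \sum_i z 0 i * dF i (x *: z)).
  by move=> /tin x1 Sz; have := is_derive_ray x1 Sz; exact: is_deriveZ.
have pE x z : `](- t), t[%classic x -> S z ->
    partial1of2 (fun s z => w z * F (s *: z)) x z = w z * \sum_i z 0 i * dF i (x *: z).
  by move=> xt Sz; rewrite partial1of2E; have [_ <-] := dE x z xt Sz.
have sI : `](- t), t[%classic s by rewrite /= in_itv/= -ltr_norml.
have intf x : `](- t), t[%classic x -> sigma.-integrable S (EFin \o (fun z => w z *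
    F (x *: z))).
  by move=> /tin x1; apply: integrable_weighted => // y by_; have [] := FP by_.
have derf x z : `](- t), t[%classic x -> S z -> derivable (fun s => w z * F (s *: z)) x 1.
  by move=> xt Sz; have [] := dE x z xt Sz.
have intC : sigma.-integrable S (EFin \o (fun _ => C)).
  apply: continuous_usphere_integrable => z _; exact: (@continuous_const R _ C z).
have bnd x z : `](- t), t[%classic x -> S z ->
    `|partial1of2 (fun s z => w z * F (s *: z)) x z| <= C.
  move=> xt Sz; rewrite pE// normrM -[X in _ <= X]mul1r ler_pM// ?w1//.
  apply: (@le_trans _ _ (\sum_i `|dF i (x *: z)|)).
    apply: (le_trans (ler_norm_sum _ _ _)); apply: ler_sum => i _.
    by rewrite normrM ler_piMl// usphere_coord.
  rewrite (le_trans (ler_norm _))//; apply: hC.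
  rewrite sqnormZ usphere_sqnorm// mulr1 -real_normK ?num_real//.
  rewrite lerXn2r ?nnegrE//.
  by move: xt; rewrite /= in_itv/= -ltr_norml => /ltW.
have H := cvg_differentiation_under_integral (@measurable_usphere R n) sI intf derf
  (fun _ => C0) intC bnd.
have <- : \int[sigma]_(z in S) partial1of2 (fun s z => w z * F (s *: z)) s z =
   \int[sigma]_(z in S) (w z * \sum_i z 0 i * dF i (s *: z)).
  apply: eq_Rintegral => z; rewrite inE => Sz; exact: pE.
split; last by apply/cvg_lim => //; under eq_fun do rewrite scaler1; exact: H.
by apply/cvg_ex; eexists; under eq_fun do rewrite scaler1; exact: H.
Qed.

End derivative.

End sphere_means.

(** * The differential equation of spherical means *)

Section sphere_mean_ode.
Context {R : realType} {n : nat}.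
Local Notation sigma := (sphere_measure R n).
Local Notation S := (@usphere R n).
Variables (v : 'rV[R]_n -> R) (g : 'I_n -> 'rV[R]_n -> R)
  (h : 'I_n -> 'I_n -> 'rV[R]_n -> R).
Hypothesis vP : C1_with (eball R n) v g.
Hypothesis gP : forall i, C1_with (eball R n) (g i) (h i).

Let ccoord (k : 'I_n) : continuous (fun x : 'rV[R]_n => x 0 k).
Proof. by move=> x; exact: (@coord_continuous R 1 n 0 k x). Qed.

Let tangential (i j : 'I_n) (y : 'rV[R]_n) := y 0 i * g j y - y 0 j * g i y.

Let dtangential (i j k : 'I_n) (y : 'rV[R]_n) :=
  y 0 i * h j k y + (i == k)%:R * g j y - (y 0 j * h i k y + (j == k)%:R * g i y).

Let tangentialP i j : C1_with (eball R n) (tangential i j) (dtangential i j).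
Proof.
move=> x bx; have gc k : {for x, continuous (g k)} by have [] := gP k bx.
have hc k l : {for x, continuous (h k l)} by have [_ /(_ l)[]] := gP k bx.
have hd k l : is_derive x 'e_l (g k) (h k l x) by have [_ /(_ l)[]] := gP k bx.
split.
  exact: (cvgB (cvgM (@ccoord i x) (gc j)) (cvgM (@ccoord j x) (gc i))).
move=> k; split.
  apply: (is_derive_eq (is_deriveB
    (is_deriveM (is_derive_coord x k i) (hd j k))
    (is_deriveM (is_derive_coord x k j) (hd i k)))).
  by rewrite /dtangential /GRing.scale/= (mulrC (_ == _)%:R) (mulrC (j == k)%:R).
have c1 := continuous_mulr_at (@ccoord i x) (hc j k).
have c2 := continuous_mulr_at (@continuous_const R _ (i == k)%:R x) (gc j).
have c3 := continuous_mulr_at (@ccoord j x) (hc i k).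
have c4 := continuous_mulr_at (@continuous_const R _ (j == k)%:R x) (gc i).
exact: (cvgB (cvgD c1 c2) (cvgD c3 c4)).
Qed.

(** The spherical Laplacian, up to the factor -2: the squares of the rotation fields, summed over i
    < j, give |y|^2 times the Laplacian minus n - 1 times the radial derivative y.grad minus the
    second radial term. The terms [h i j] and [h j i] are matched by exchanging the two sums, not by
    symmetry of the second derivatives. *)
Let sum_tangential (y : 'rV[R]_n) :
  \sum_i \sum_j (if i == j then 0 else angular (dtangential i j) i j y) =
  2 * ((n%:R - 1) * (\sum_i y 0 i * g i y) +
       \sum_i \sum_j y 0 i * (y 0 j * h i j y) - sqnorm y * \sum_i h i i y).
Proof.
pose H := \sum_i y 0 i * g i y.
pose Q := \sum_i \sum_j y 0 i * (y 0 j * h i j y).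
pose L := \sum_i h i i y.
(* At i = j the second-order terms cancel and [2 * (y 0 i * g i y)] is left over, hence the
   correction by [(i == j)%:R]. *)
have E i j : (if i == j then 0 else angular (dtangential i j) i j y) =
   y 0 j * g j y + y 0 j * (y 0 i * h j i y) - y 0 j ^+ 2 * h i i y
   + (y 0 i * g i y + y 0 i * (y 0 j * h i j y) - y 0 i ^+ 2 * h j j y)
   - (i == j)%:R * (2 * (y 0 i * g i y)).
  case: eqVneq => [->|ij]; first by rewrite mul1r; ring.
  by rewrite /angular /dtangential !eqxx (negbTE ij) eq_sym (negbTE ij)/=; ring.
under eq_bigr do under eq_bigr do rewrite E.
have -> : \sum_i \sum_j (y 0 j * g j y + y 0 j * (y 0 i * h j i y) - y 0 j ^+ 2 * h i i y
   + (y 0 i * g i y + y 0 i * (y 0 j * h i j y) - y 0 i ^+ 2 * h j j y)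
   - (i == j)%:R * (2 * (y 0 i * g i y))) =
   \sum_(i < n) \sum_j (y 0 j * g j y) + \sum_i \sum_j y 0 j * (y 0 i * h j i y)
   - \sum_i \sum_j y 0 j ^+ 2 * h i i y
   + (\sum_i \sum_(j < n) (y 0 i * g i y) + Q - \sum_i \sum_j y 0 i ^+ 2 * h j j y)
   - \sum_i \sum_j (i == j)%:R * (2 * (y 0 i * g i y)).
  rewrite -!(big_split, sumrN)/=; apply: eq_bigr => i _.
  by rewrite -!(big_split, sumrN)/=; apply: eq_bigr => j _.
have -> : \sum_(i < n) \sum_j (y 0 j * g j y) = n%:R * H.
  by rewrite sumr_const card_ord mulr_natl.
have -> : \sum_i \sum_(j < n) (y 0 i * g i y) = n%:R * H.
  by rewrite exchange_big sumr_const card_ord mulr_natl.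
have -> : \sum_i \sum_j y 0 j * (y 0 i * h j i y) = Q by rewrite exchange_big.
have -> : \sum_i \sum_j y 0 j ^+ 2 * h i i y = sqnorm y * L.
  by rewrite mulr_sumr; apply: eq_bigr => i _; rewrite mulr_suml.
have -> : \sum_i \sum_j y 0 i ^+ 2 * h j j y = sqnorm y * L.
  by rewrite mulr_suml; apply: eq_bigr => i _; rewrite mulr_sumr.
have -> : \sum_i \sum_j (i == j)%:R * (2 * (y 0 i * g i y)) = 2 * H.
  rewrite mulr_sumr; apply: eq_bigr => i _.
  rewrite (bigD1 i)//= eqxx mul1r big1 ?addr0// => j /negbTE ji.
  by rewrite eq_sym ji mul0r.
by rewrite -/H -/Q -/L; ring.
Qed.

Let integral_angular i j (s : R) : 0 <= s < 1 -> i != j ->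
  \int[sigma]_(z in S) angular (dtangential i j) i j (s *: z) = 0.
Proof.
move=> s01 ij; rewrite /Rintegral integral_usphere_eq0//.
  apply: continuous_measurable_rV => z; rewrite inE => Sz.
  apply: continuous_scale_at; apply: (angular_continuous (tangentialP i j)).
  by apply: usphere_eball => //; case/andP : s01 => s0 ->; rewrite andbT
      (lt_le_trans _ s0)// ltrN10.
exact: (integral_angular_ball (tangentialP i j)).
Qed.

Definition mean1 (s : R) := \sum_i \int[sigma]_(z in S) (z 0 i * g i (s *: z)).

Definition mean2 (s : R) :=
  \sum_i \int[sigma]_(z in S) (z 0 i * \sum_j z 0 j * h i j (s *: z)).

Let gcont i y : eball R n y -> {for y, continuous (g i)}.
Proof. by move=> by_; have [] := gP i by_. Qed.

Let hcont i j y : eball R n y -> {for y, continuous (h i j)}.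
Proof. by move=> by_; have [_ /(_ j)[]] := gP i by_. Qed.

Let continuous_integrable (w G : 'rV[R]_n -> R) (s : R) : continuous w ->
  (forall y, eball R n y -> {for y, continuous G}) -> -1 < s < 1 ->
  sigma.-integrable S (EFin \o (fun z => w z * G (s *: z))).
Proof.
by move=> cw cG s1; exact: integrable_weighted.
Qed.

Lemma is_derive_mean1 (s : R) : -1 < s < 1 ->
  is_derive s 1 (fun s => \int[sigma]_(z in S) v (s *: z)) (mean1 s).
Proof.
move=> s1.
have := @is_derive_mean _ _ (cst 1) v g (@continuous_const R _ 1) _ vP _ s1.
under eq_fun do under eq_Rintegral do rewrite mul1r.
under eq_Rintegral do rewrite mul1r.
rewrite Rintegral_sumr; [|exact: measurable_usphere|].
  by apply => z _; rewrite normr1.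
by move=> i; exact: (continuous_integrable (@ccoord i) (@gcont i) s1).
Qed.

Lemma is_derive_mean2 (s : R) : -1 < s < 1 -> is_derive s 1 mean1 (mean2 s).
Proof.
move=> s1; apply: is_derive_sumr => i.
apply: (@is_derive_mean _ _ (fun z : 'rV[R]_n => z 0 i) (g i) (h i)) => //.
  by move=> z; exact: usphere_coord.
Qed.

(** The integral over the sphere of [sum_tangential] at y = s z vanishes, rotation derivatives
    having mean zero; dividing by 2 s gives the equation. *)
Lemma mean_ode (s : R) : 0 < s < 1 ->
  s * mean2 s + (n%:R - 1) * mean1 s =
  s * \int[sigma]_(z in S) \sum_i h i i (s *: z).
Proof.
move=> /andP[s0 s1]; have s01 : 0 <= s < 1 by rewrite ltW.
have ss1 : -1 < s < 1 by rewrite s1 (lt_trans _ s0)// ltrN10.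
have mS := @measurable_usphere R n.
have int_ang i j : sigma.-integrable S (EFin \o
    (fun z => if i == j then 0 else angular (dtangential i j) i j (s *: z))).
  apply: continuous_usphere_integrable => z; rewrite inE => Sz.
  case: eqP => _; first exact: (@continuous_const R _ 0 z).
  apply: continuous_scale_at; apply: (angular_continuous (tangentialP i j)).
  exact: usphere_eball.
have intg i : sigma.-integrable S (EFin \o (fun z : 'rV[R]_n => z 0 i * g i (s *: z))).
  exact: (continuous_integrable (@ccoord i) (@gcont i) ss1).
have inth i j : sigma.-integrable S (EFin \o (fun z : 'rV[R]_n => z 0 i * (z 0 j *
    h i j (s *: z)))).
  rewrite (_ : (fun _ => _) = fun z : 'rV[R]_n => (z 0 i * z 0 j) * h i j (s *: z)).
    exact: (continuous_integrable (continuous_mulr (@ccoord i) (@ccoord j)) (@hcont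
        i j) ss1).
  by apply/funext => z; rewrite mulrA.
have intl i : sigma.-integrable S (EFin \o (fun z : 'rV[R]_n => h i i (s *: z))).
  rewrite (_ : (fun _ => _) = fun z : 'rV[R]_n => 1 * h i i (s *: z)).
    exact: (continuous_integrable (@continuous_const R _ 1) (@hcont i i) ss1).
  by apply/funext => z; rewrite mul1r.
have sum_int I (r : seq I) (f : I -> 'rV[R]_n -> R) :
    (forall i, sigma.-integrable S (EFin \o f i)) ->
    sigma.-integrable S (EFin \o (fun z => \sum_(i <- r) f i z)).
  move=> fi; rewrite (_ : EFin \o _ = (fun z => \sum_(i <- r) (f i z)%:E)%E).
    by apply: integrable_sum => // i _; exact: fi.
  by apply/funext => z; rewrite /= sumEFin.
have : \int[sigma]_(z in S) (\sum_i \sum_j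
    (if i == j then 0 else angular (dtangential i j) i j (s *: z))) = 0.
  rewrite Rintegral_sumr//; last by move=> i; exact: sum_int.
  rewrite big1// => i _; rewrite Rintegral_sumr// big1// => j _.
  case: eqVneq => [_|ij]; first by rewrite Rintegral_cst// mul0r.
  exact: integral_angular.
pose HH (z : 'rV[R]_n) := \sum_i z 0 i * g i (s *: z).
pose QQ (z : 'rV[R]_n) := \sum_i \sum_j z 0 i * (z 0 j * h i j (s *: z)).
pose LL (z : 'rV[R]_n) := \sum_i h i i (s *: z).
have iH : sigma.-integrable S (EFin \o HH) by exact: sum_int.
have iQ : sigma.-integrable S (EFin \o QQ) by apply: (@sum_int) => i; exact: sum_int.
have iL : sigma.-integrable S (EFin \o LL) by exact: sum_int.
have iZ a f : sigma.-integrable S (EFin \o f) ->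
    sigma.-integrable S (EFin \o (fun z => a * f z)).
  by move=> fi; exact: (integrableZl mS a fi).
have E : {in S, (fun z => \sum_i \sum_j
    (if i == j then 0 else angular (dtangential i j) i j (s *: z))) =1
    (fun z => (2 * (n%:R - 1) * s) * HH z + (2 * s ^+ 2) * QQ z - (2 * s ^+ 2) * LL z)}.
  move=> z; rewrite inE => Sz; rewrite sum_tangential sqnormZ usphere_sqnorm//.
  have -> : \sum_i (s *: z) 0 i * g i (s *: z) = s * HH z.
    by rewrite mulr_sumr; apply: eq_bigr => i _; rewrite mxE mulrA.
  have -> : \sum_i \sum_j (s *: z) 0 i * ((s *: z) 0 j * h i j (s *: z)) = s ^+ 2 * QQ z.
    rewrite mulr_sumr; apply: eq_bigr => i _; rewrite mulr_sumr; apply: eq_bigr => j _.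
    by rewrite !mxE; ring.
  by rewrite -/(LL z); ring.
rewrite (eq_Rintegral _ E).
have iD := integrableD mS (iZ (2 * (n%:R - 1) * s) _ iH) (iZ (2 * s ^+ 2) _ iQ).
rewrite RintegralB//; last exact: iZ.
rewrite RintegralD//; [|exact: iZ|exact: iZ].
rewrite !RintegralZl//.
have -> : \int[sigma]_(z in S) HH z = mean1 s by rewrite Rintegral_sumr.
have -> : \int[sigma]_(z in S) QQ z = mean2 s.
  rewrite Rintegral_sumr//; last by move=> i; exact: sum_int.
  by apply: eq_bigr => i _; apply: eq_Rintegral => z _; rewrite mulr_sumr.
move=> h0; have s20 : 2 * s != 0 by rewrite mulf_neq0// ?gt_eqF.
by apply: (mulfI s20); rewrite -/LL; apply/eqP; rewrite -subr_eq0 -h0; apply/eqP; ring.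
Qed.

End sphere_mean_ode.

Section within_continuous.
Context {R : realType} {T : topologicalType}.
Implicit Types (A : set T) (f g : T -> R).

Lemma within_cM A f g : {within A, continuous f} -> {within A, continuous g} ->
  {within A, continuous (fun x => f x * g x)}.
Proof. by move=> cf cg x; apply: continuousM; [exact: cf|exact: cg]. Qed.

Lemma within_cD A f g : {within A, continuous f} -> {within A, continuous g} ->
  {within A, continuous (fun x => f x + g x)}.
Proof. by move=> cf cg x; apply: continuousD; [exact: cf|exact: cg]. Qed.

End within_continuous.

(** * Comparison for the radial differential inequality *)

Section radial_ode.
Context {R : realType}.
Variables (n : nat) (y y1 y2 : R -> R).
Hypothesis n2 : (2 <= n)%N.
Hypothesis yP : forall s : R, -1 < s < 1 -> is_derive s 1 y (y1 s).
Hypothesis y1P : forall s : R, -1 < s < 1 -> is_derive s 1 y1 (y2 s).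

Let in_ball (s : R) : 0 <= s < 1 -> -1 < s < 1.
Proof. by move=> /andP[s0 ->]; rewrite andbT (lt_le_trans _ s0)// ltrN10. Qed.

(** The function t^(n-1) y1(t) vanishes at 0, and its derivative is t^(n-2) times the quantity
    assumed nonnegative; hence [y1] is nonnegative on ]0, 1[. *)
Lemma radial_ode_homo :
  (forall s : R, 0 < s < 1 -> 0 <= s * y2 s + (n%:R - 1) * y1 s) ->
  forall a b : R, 0 <= a -> a <= b -> b < 1 -> y a <= y b.
Proof.
move=> yge a b a0 ab b1.
have y1_ge0 (s : R) : 0 < s < 1 -> 0 <= y1 s.
  move=> /andP[s0 s1].
  pose p t := t ^+ n.-1 * y1 t.
  pose dp t := t ^+ n.-1 * y2 t + y1 t * (n.-1%:R * t ^+ n.-2).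
  have pP (t : R) : -1 < t < 1 -> is_derive t 1 p (dp t).
    move=> /y1P h; exact: (is_derive_eq (is_deriveM (is_deriveXn n.-1 t) h)).
  have [||c] := @MVT _ p dp 0 s s0.
  - move=> t; rewrite in_itv/= => /andP[t0 ts]; apply: pP.
    by apply: in_ball; rewrite ltW//= (lt_trans ts).
  - apply: derivable_within_continuous => t; rewrite in_itv/= => /andP[t0 ts].
    by have [] := pP t (in_ball (introT andP (conj t0 (le_lt_trans ts s1)))).
  rewrite in_itv/= => /andP[c0 cs]; rewrite subr0.
  have E : dp c = c ^+ n.-2 * (c * y2 c + (n%:R - 1) * y1 c).
    rewrite /dp; case: n n2 => // -[//|m] _ /=.
    by rewrite exprS [in RHS](natrD _ 1 m.+1) ; ring.
  have n1 : (0 < n.-1)%N by case: n n2 => // -[].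
  have -> : p 0 = 0 by rewrite /p expr0n gtn_eqF// mul0r.
  rewrite subr0 => ps.
  have : 0 <= p s.
    rewrite ps mulr_ge0 ?(ltW s0)// E mulr_ge0// ?exprn_ge0 ?(ltW c0)//.
    by apply: yge; rewrite c0 (lt_trans cs).
  by rewrite /p pmulr_rge0// exprn_gt0.
have [->//|ab'] := eqVneq a b; have {}ab : a < b by rewrite lt_neqAle ab'.
have inI (t : R) : a <= t <= b -> -1 < t < 1.
  by move=> /andP[at_ tb]; apply: in_ball; rewrite (le_trans a0 at_) (le_lt_trans tb b1).
have [||c] := @MVT _ y y1 a b ab.
- move=> t; rewrite in_itv/= => /andP[t0 ts]; apply: yP.
  by apply: inI; rewrite !ltW.
- apply: derivable_within_continuous => t; rewrite in_itv/= => /inI/yP[] //.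
rewrite in_itv/= => /andP[ac cb] E.
rewrite -subr_ge0 E mulr_ge0 ?subr_ge0 ?(ltW ab)// y1_ge0//.
by rewrite (le_lt_trans a0 ac) (lt_trans cb).
Qed.

Variables (w dw : R -> R).
Hypothesis wP : forall t : R, 0 < t < 1 -> is_derive t 1 w (dw t).
Hypothesis cw : {within `[0, 1], continuous w}.
Hypothesis w_ge0 : forall t : R, 0 < t < 1 -> 0 <= w t.
Hypothesis w0 : w 0 = 0.
Hypothesis w1 : w 1 = 0.
Hypothesis wE : forall t : R, 0 < t < 1 -> t * dw t = (n%:R - 1) * w t - t.

(* With w = t g(t), the function w Y' + Y, Y(t) = y(rt), has derivative
   g (t Y'' + (n-1) Y'): this is Green's representation for radial functions. *)
Lemma radial_ode_le (r : R) (k : R -> R) : 0 <= r < 1 ->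
  {within `[0, 1], continuous k} ->
  (forall t : R, 0 < t < 1 ->
    r * t * y2 (r * t) + (n%:R - 1) * y1 (r * t) <= r * t * k t) ->
  y r - y 0 <= r ^+ 2 * \int[lebesgue_measure]_(t in `[0, 1]) (w t * k t).
Proof.
move=> /andP[r0 r1] ck yk.
have rt (t : R) : 0 <= t <= 1 -> -1 < r * t < 1.
  move=> /andP[t0 t1]; apply: in_ball; rewrite mulr_ge0//=.
  by apply: le_lt_trans r1; rewrite ler_piMr.
have hr (t : R) : is_derive t 1 (fun t : R => r * t) r.
  by apply: is_derive_eq; rewrite /GRing.scale/= mulr1.
have YP (t : R) : 0 <= t <= 1 -> is_derive t 1 (fun t => y (r * t)) (r * y1 (r * t)).
  move=> /rt/yP h; rewrite mulrC; exact: (is_derive1_comp h (hr t)).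
have Y1P (t : R) : 0 <= t <= 1 -> is_derive t 1 (fun t => r * y1 (r * t)) (r * (r *
    y2 (r * t))).
  move=> /rt/y1P h; apply: is_deriveZ; rewrite mulrC.
  exact: (is_derive1_comp h (hr t)).
pose f t := w t * k t.
have cf : {within `[0, 1], continuous f}.
  exact: within_cM.
have intf : lebesgue_measure.-integrable `[0, 1] (EFin \o f).
  by apply: continuous_compact_integrable => //; exact: segment_compact.
pose J x := \int[lebesgue_measure]_(t in `[0, x]) f t.
have cJ : {within `[0, 1], continuous J}.
  exact: (parameterized_integral_continuous ler01 intf).
have JP (t : R) : 0 < t < 1 -> is_derive t 1 J (f t).
  move=> /andP[t0 t1].
  have ft : {for t, continuous f}.
    by apply: (within_continuous_continuous ltr01 cf); rewrite in_itv/= t0.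
  have [d1 d2] := @continuous_FTC1 R f (BLeft 0) t 1 t1 intf t0 ft.
  by split; [exact: d1|rewrite -derive1E; exact: d2].
(* Subtracting the primitive [J] turns the claim into [Q 1 <= Q 0], as [w] vanishes at both ends.
   The monotonicity criterion asks for derivatives inside the interval only, which suits t log(1/t),
   not differentiable at 0. *)
pose Q t := w t * (r * y1 (r * t)) + y (r * t) - r ^+ 2 * J t.
pose dQ t := dw t * (r * y1 (r * t)) + w t * (r * (r * y2 (r * t)))
  + r * y1 (r * t) - r ^+ 2 * f t.
have QP (t : R) : 0 < t < 1 -> is_derive t 1 Q (dQ t).
  move=> t01; have t01' : 0 <= t <= 1 by case/andP : t01 => a b; rewrite !ltW.
  apply: (is_derive_eq (is_deriveB
    (is_deriveD (is_deriveM (wP t01) (Y1P t t01')) (YP t t01'))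
    (is_deriveZ (r ^+ 2) (JP t t01)))).
  by rewrite /dQ /GRing.scale/=; ring.
have cQ : {within `[0, 1], continuous Q}.
  have cY : {within `[0, 1], continuous (fun t => y (r * t))}.
    by apply: derivable_within_continuous => t; rewrite in_itv/= => /YP[].
  have cY1 : {within `[0, 1], continuous (fun t => r * y1 (r * t))}.
    by apply: derivable_within_continuous => t; rewrite in_itv/= => /Y1P[].
  have cr : {within `[0, 1], continuous (fun _ : R => - r ^+ 2)}.
    by apply: continuous_subspaceT; exact: continuous_const.
  have c3 := within_cD (within_cD (within_cM cw cY1) cY) (within_cM cr cJ).
  rewrite (_ : Q = fun t => w t * (r * y1 (r * t)) + y (r * t) + - r ^+ 2 * J t).
    exact: c3.
  by apply/funext => t; rewrite mulNr.
have : Q 1 <= Q 0.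
  apply: (@ler0_derive1_nincr _ Q 0 1) => //; rewrite ?ler01//.
  - by move=> t; rewrite in_itv/= => /QP[].
  - move=> t; rewrite in_itv/= => t01; rewrite derive1E.
    have [_ ->] := QP t t01; case/andP : (t01) => t0 t1.
    rewrite -(pmulr_rle0 _ t0).
    have -> : t * dQ t = r * w t *
        ((r * t * y2 (r * t) + (n%:R - 1) * y1 (r * t)) - r * t * k t).
      rewrite /dQ /f !mulrDr; move: (wE t01) => E.
      have -> : t * (dw t * (r * y1 (r * t))) = (t * dw t) * (r * y1 (r * t)) by ring.
      by rewrite E; ring.
    by apply: mulr_ge0_le0; [rewrite mulr_ge0 ?w_ge0|rewrite subr_le0 yk].
rewrite /Q w0 w1 !mul0r !add0r mulr1 mulr0.
have -> : J 0 = 0 by rewrite /J set_itv1 Rintegral_set1.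
by rewrite mulr0 subr0 lerBlDr lerBlDl.
Qed.

End radial_ode.

(** * Powers of absolute values and Young's inequality *)

Section abs_powers.
Context {R : realType}.
Implicit Types (x p nu : R).

Lemma continuous_abs_powR p : 0 <= p -> continuous (fun x => `|x| `^ p).
Proof.
rewrite le_eqVlt => /predU1P[<-|p0] x.
  rewrite (_ : (fun _ => _) = fun=> 1); first exact: (@continuous_const R R 1 x).
  by apply/funext => t; rewrite powRr0.
have c0 : `|t| `^ p @[t --> (0 : R)] --> (0 : R).
  apply/cvgrPdist_lt => e e0; near=> t.
  rewrite sub0r normrN ger0_norm ?powR_ge0//.
  have -> : e = (e `^ p^-1) `^ p by rewrite -powRrM mulVf ?gt_eqF// powRr1// ltW.
  apply: gt0_ltr_powR; rewrite ?nnegrE ?powR_ge0//.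
  near: t; exists (e `^ p^-1) => /=; first by rewrite powR_gt0.
  by move=> t /=; rewrite sub0r normrN.
have [->|x0] := eqVneq x 0.
  by rewrite /continuous_at normr0 powR0 ?gt_eqF//; exact: c0.
have h : {for `|x|, continuous (fun t : R => t `^ p)}.
  by apply: is_derive_continuous; apply: is_derive1_powR; rewrite normr_gt0.
exact: (cvg_comp _ _ (@norm_continuous _ _ x) h).
Unshelve. all: by end_near. Qed.

Lemma is_derive_abs_powR_id p x : 0 <= p ->
  is_derive x 1 (fun t => t * `|t| `^ p) ((p + 1) * `|x| `^ p).
Proof.
move=> p0.
have pos (y : R) : 0 < y -> is_derive y 1 (fun t => t * `|t| `^ p) ((p + 1) * `|y| `^ p).
  move=> y0; have h := is_deriveM (is_derive_id y (1 : R)) (is_derive1_powR p y0).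
  apply: (near_eq_is_derive (f := fun t : R => t * t `^ p)).
    near=> t; rewrite gtr0_norm//.
    by near: t; exact: lt_nbhsr.
  apply: (is_derive_eq h).
  have E : y * y `^ (p - 1) = y `^ p.
    rewrite powRB ?(gt_eqF y0) ?implybT//.
    by rewrite (powRr1 (ltW y0)) mulrC divfK// gt_eqF.
  by rewrite /GRing.scale/= mulr1 gtr0_norm// mulrCA E; ring.
have [x0|x0|->] := ltgtP x 0; last 2 first.
- exact: pos.
- have c0 := @continuous_abs_powR p p0 0.
  apply: (is_derive_eq (is_derive_mul_id0 c0)).
  rewrite normr0; have [->|pn0] := eqVneq p 0; first by rewrite powRr0 add0r mulr1.
  by rewrite powR0// mulr0.
have hN : is_derive x 1 (fun t : R => - t) (- 1).
  exact: is_deriveN (is_derive_id x (1 : R)).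
have xN : 0 < - x by rewrite oppr_gt0.
have h := is_deriveN (is_derive1_comp (pos _ xN) hN).
rewrite (_ : (fun _ => _) = - ((fun t => t * `|t| `^ p) \o (fun t : R => - t))).
  by apply: (is_derive_eq h); rewrite normrN; ring.
by apply/funext => t; rewrite fctE/= normrN mulNr opprK.
Unshelve. all: by end_near. Qed.

Lemma abs_powR_split nu x : 2 <= nu -> x ^+ 2 * `|x| `^ (nu - 2) = `|x| `^ nu.
Proof.
move=> nu2; rewrite -real_normK ?num_real//.
have [->|t0] := eqVneq x 0.
  by rewrite normr0 expr0n mul0r powR0// gt_eqF// (lt_le_trans _ nu2).
rewrite -powR_mulrn// -powRD; last by rewrite normr_eq0 t0 implybT.
by congr powR; ring.
Qed.

(** Writing |t|^nu as t times t |t|^(nu-2) reduces this to the previous derivative, with no case on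
    the sign of t. *)
Lemma is_derive_abs_powR nu x : 2 <= nu ->
  is_derive x 1 (fun t => `|t| `^ nu) (nu * (x * `|x| `^ (nu - 2))).
Proof.
move=> nu2; have p0 : 0 <= nu - 2 by rewrite subr_ge0.
have h := is_deriveM (is_derive_id x (1 : R)) (is_derive_abs_powR_id x p0).
rewrite (_ : (fun _ => _) = id * (fun t => t * `|t| `^ (nu - 2))).
  by apply: (is_derive_eq h); rewrite /GRing.scale/=; ring.
by apply/funext => t; rewrite fctE/= mulrA -expr2 abs_powR_split.
Qed.

(** Young's inequality with conjugate exponents nu / (nu-2) and nu / 2; the first degenerates for nu
    = 2, where the two sides are equal. *)
Lemma young_powR (nu x y : R) : 2 <= nu -> 0 <= x -> 0 <= y ->
  x `^ (nu - 2) * y ^+ 2 <= (nu - 2) / nu * x `^ nu + 2 / nu * y `^ nu.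
Proof.
move=> nu2 x0 y0; have nu0 : 0 < nu by apply: lt_le_trans nu2.
have [->|nun2] := eqVneq nu 2.
  by rewrite subrr mul0r powRr0 mul0r !mul1r add0r divff// mul1r powR_mulrn.
have nu2' : 0 < nu - 2 by rewrite subr_gt0 lt_neqAle eq_sym nun2.
have := @conjugate_powR R (x `^ (nu - 2)) (y ^+ 2) (nu / (nu - 2)) (nu / 2).
rewrite powR_ge0 exprn_ge0// !divr_gt0// => /(_ isT isT isT isT).
rewrite !invf_div -mulrDl subrK divff ?gt_eqF// => /(_ erefl).
rewrite -powRrM -powR_mulrn// -powRrM.
rewrite (_ : (nu - 2) * _ = nu); last by rewrite mulrCA divff ?gt_eqF// mulr1.
rewrite (_ : 2%:R * _ = nu); last by rewrite mulrCA divff ?mulr1.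
by rewrite [X in _ <= X + _]mulrC [X in _ <= _ + X]mulrC.
Qed.

End abs_powers.

(** * The function phi and the radial weights *)

Section phi_function.
Context {R : realType}.
Variables (alpha beta : R).
Hypothesis alpha0 : 0 < alpha.
Hypothesis beta_le : beta <= alpha.

Let base_ge1 (s : R) : 0 <= s < 1 -> 1 <= 1 - ln (1 - s).
Proof. by move=> /andP[s0 s1]; rewrite lerBrDr gerDl ln_le0// gerBl. Qed.

Lemma phi_gt0 (s : R) : 0 <= s < 1 -> 0 < phi alpha beta s.
Proof.
move=> s01; have := base_ge1 s01; case/andP : s01 => s0 s1 b1.
by apply: mulr_gt0; apply: powR_gt0; [rewrite subr_gt0|exact: lt_le_trans b1].
Qed.

(** Since 1 - log(1-s) >= 1 and beta <= alpha, phi is at most the power alpha of (1-s)(1 -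
    log(1-s)), and log x <= x - 1 at x = 1/(1-s) bounds this product by 1. *)
Lemma phi_le1 (s : R) : 0 <= s < 1 -> phi alpha beta s <= 1.
Proof.
move=> s01; have b1 := base_ge1 s01; case/andP : s01 => s0 s1.
have s1' : 0 < 1 - s by rewrite subr_gt0.
have b0 : 0 <= 1 - ln (1 - s) by rewrite (le_trans _ b1).
apply: (@le_trans _ _ ((1 - s) `^ alpha * (1 - ln (1 - s)) `^ alpha)).
  by rewrite ler_wpM2l ?powR_ge0// ler_powR.
rewrite -powRM ?(ltW s1')//.
suff h : (1 - s) * (1 - ln (1 - s)) <= 1.
  have := ge0_ler_powR (ltW alpha0) _ _ h.
  by rewrite powR1 !nnegrE mulr_ge0 ?(ltW s1')// => /(_ isT ler01).
have : ln ((1 - s)^-1) <= (1 - s)^-1 - 1.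
  have := @le_ln1Dx R ((1 - s)^-1 - 1); rewrite addrCA subrr addr0; apply.
  by rewrite ltrBrDr addrC subrr invr_gt0.
rewrite lnV ?posrE// lerBrDr addrC => h.
have := ler_wpM2l (ltW s1') h; rewrite divff ?gt_eqF//.
Qed.

Lemma continuous_phi (s : R) : s < 1 -> 0 <= s -> {for s, continuous (phi alpha beta)}.
Proof.
move=> s1 s0; have s1' : 0 < 1 - s by rewrite subr_gt0.
have cs : {for s, continuous (fun t : R => 1 - t)}.
  exact: (cvgB (@cvg_cst _ (1 : R) _ (nbhs s) _) cvg_id).
have cpow a (x : R) : 0 < x -> {for x, continuous (fun t : R => t `^ a)}.
  by move=> x0; apply: is_derive_continuous; exact: is_derive1_powR.
have c1 : {for s, continuous (fun t : R => (1 - t) `^ alpha)}.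
  exact: (cvg_comp _ _ cs (cpow alpha _ s1')).
have c2 : {for s, continuous (fun t : R => ln (1 - t))}.
  exact: (cvg_comp _ _ cs (@continuous_ln R _ s1')).
have c3 : {for s, continuous (fun t : R => 1 - ln (1 - t))}.
  exact: (cvgB (@cvg_cst _ (1 : R) _ (nbhs s) _) c2).
have b0 : 0 < 1 - ln (1 - s) by apply: lt_le_trans (base_ge1 _); rewrite ?s0.
have c4 : {for s, continuous (fun t : R => (1 - ln (1 - t)) `^ beta)}.
  exact: (cvg_comp _ _ c3 (cpow beta _ b0)).
have c5 := continuous_mulr_at c1 c4; exact: c5.
Qed.

Lemma within_continuous_phiV (r : R) : 0 <= r < 1 ->
  {within `[0, 1], continuous (fun t => (phi alpha beta (r * t) ^+ 2)^-1)}.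
Proof.
move=> /andP[r0 r1]; apply: continuous_in_subspaceT => t.
rewrite inE/= in_itv/= => /andP[t0 t1].
have rt0 : 0 <= r * t by rewrite mulr_ge0.
have rt1 : r * t < 1 by apply: le_lt_trans r1; rewrite ler_piMr.
have c1 : r * x @[x --> t] --> r * t by apply: cvgM; [exact: cvg_cst|exact: cvg_id].
have c2 := cvg_comp _ _ c1 (continuous_phi rt1 rt0).
have c3 : (fun x => phi alpha beta (r * x) ^+ 2) @ t --> phi alpha beta (r * t) ^+ 2.
  by under eq_fun do rewrite expr2; rewrite expr2; exact: (cvgM c2 c2).
apply: (cvgV _ c3); rewrite expf_eq0/= gt_eqF// phi_gt0//.
by rewrite rt0.
Qed.

Lemma majorant_phi (omega : R -> R) (s : R) : majorant omega -> 0 <= s < 1 ->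
  0 < omega 1 /\ omega 1 * phi alpha beta s <= omega (phi alpha beta s).
Proof.
move=> [_ _ inc om0 dec] s01; split; first by rewrite -om0; apply: inc.
have := dec _ _ (phi_gt0 s01) (phi_le1 s01).
by rewrite divr1 ler_pdivlMr// phi_gt0.
Qed.

End phi_function.

Section weights.
Context {R : realType}.

Section dim_ge3.
Variable n : nat.
Hypothesis n3 : (3 <= n)%N.

(* t g(t), for g the radial Green function (1 - t^(n-2)) / (n-2) if n >= 3 and
   log(1/t) if n = 2. *)
Definition weight (t : R) := (n%:R - 2)^-1 * (t * (1 - t ^+ (n - 2))).
Definition dweight (t : R) := (n%:R - 2)^-1 * (1 - (n%:R - 1) * t ^+ (n - 2)).

Let n2_gt0 : 0 < n%:R - 2 :> R.
Proof. by rewrite subr_gt0 ltr_nat. Qed.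

Lemma is_derive_weight (t : R) : is_derive t 1 weight (dweight t).
Proof.
have h := is_deriveM (is_derive_id t (1 : R))
  (is_deriveB (is_derive_cst (1 : R) t (1 : R)) (is_deriveXn (n - 2) t)).
apply: (is_derive_eq (is_deriveZ (n%:R - 2)^-1 h)).
rewrite /dweight /GRing.scale/=; congr (_ * _).
case: n n3 => [|[|[|m]]]// _; rewrite (_ : (m.+3 - 2 = m.+1)%N)//=.
by rewrite !fctE/= exprS sub0r -[m.+3]addn2 natrD -[m.+1]addn1 natrD; ring.
Qed.

Lemma weight_ge0 t : 0 < t < 1 -> 0 <= weight t.
Proof.
move=> /andP[t0 t1]; rewrite mulr_ge0 ?invr_ge0 ?(ltW n2_gt0)//.
by rewrite mulr_ge0 ?(ltW t0)// subr_ge0 exprn_ile1 ?ltW.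
Qed.

Lemma weight0 : weight 0 = 0. Proof. by rewrite /weight mul0r mulr0. Qed.

Lemma weight1 : weight 1 = 0.
Proof. by rewrite /weight expr1n subrr !mulr0. Qed.

(** For w = t g this reads w' + 1 = (n-1) g, so the coefficient of Y' in the derivative of w Y' + Y
    is (n-1) g, beside t g for Y''. *)
Lemma weightE t : t * dweight t = (n%:R - 1) * weight t - t.
Proof.
rewrite /weight /dweight; set e := t ^+ _.
by field; exact: lt0r_neq0.
Qed.

End dim_ge3.

Definition weight2 (t : R) := t * ln (t^-1).
Definition dweight2 (t : R) := ln (t^-1) - 1.

Lemma is_derive_weight2 (t : R) : 0 < t -> is_derive t 1 weight2 (dweight2 t).
Proof.
move=> t0; have h := is_deriveM (is_derive_id t (1 : R)) (is_deriveN (is_derive1_ln t0)).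
apply: (near_eq_is_derive (f := fun t : R => t * - ln t)).
  near=> s; rewrite /weight2 lnV// posrE.
  by near: s; exact: lt_nbhsr.
apply: (is_derive_eq h); rewrite /dweight2 lnV ?posrE// /GRing.scale/= mulr1.
by rewrite mulrN divff ?gt_eqF// addrC.
Unshelve. all: by end_near. Qed.

Lemma weight2_ge0 t : 0 < t < 1 -> 0 <= weight2 t.
Proof.
by move=> /andP[t0 t1]; rewrite mulr_ge0 ?(ltW t0)// ln_ge0// invf_ge1// ltW.
Qed.

Lemma weight2_0 : weight2 0 = 0. Proof. by rewrite /weight2 mul0r. Qed.

Lemma weight2_1 : weight2 1 = 0. Proof. by rewrite /weight2 invr1 ln1 mulr0. Qed.

Lemma weight2E t : t * dweight2 t = (2%:R - 1) * weight2 t - t.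
Proof. by rewrite /weight2 /dweight2; ring. Qed.

(** The inequality log x < x at x = t^(-1/2); it serves for continuity at 0. *)
Lemma weight2_le t : 0 < t -> weight2 t <= 2 * Num.sqrt t.
Proof.
move=> t0; have st0 : 0 < Num.sqrt t by rewrite sqrtr_gt0.
have -> : weight2 t = 2 * (t * ln (Num.sqrt t)^-1).
  rewrite /weight2 -[t in t^-1](sqr_sqrtr (ltW t0)) -exprVn lnXn ?invr_gt0//.
  by rewrite -mulr_natl; ring.
rewrite ler_pM2l//; apply: le_trans (_ : t * (Num.sqrt t)^-1 <= _).
  by rewrite ler_pM2l// ltW// ln_sublinear// invr_gt0.
by rewrite -[X in X / _](sqr_sqrtr (ltW t0)) expr2 mulfK ?gt_eqF.
Qed.

Lemma within_continuous_weight2 : {within `[0, 1], continuous weight2}.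
Proof.
apply: continuous_in_subspaceT => t; rewrite inE/= in_itv/= => /andP[].
rewrite le_eqVlt => /predU1P[<- _|t0 _]; last first.
  exact: (is_derive_continuous (is_derive_weight2 t0)).
suff c0 : weight2 t @[t --> (0 : R)] --> (0 : R) by rewrite /continuous_at weight2_0.
apply/cvgrPdist_lt => e e0.
have e2 : 0 < 2^-1 * e by rewrite mulr_gt0// invr_gt0.
near=> x; rewrite sub0r normrN.
(* The limit is two-sided; for x <= 0 the weight is 0, by the default value of [ln]. *)
have [x0|x0] := leP x 0.
  by rewrite /weight2 ln0 ?mulr0 ?normr0// invr_le0.
have x1 : x < 1 by near: x; exact: lt_nbhsl.
rewrite ger0_norm ?weight2_ge0 ?x0// (le_lt_trans (weight2_le x0))//.
rewrite -ltr_pdivlMl// -[X in _ < X](gtr0_norm e2) -sqrtr_sqr ltr_sqrt ?exprn_gt0//.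
by near: x; apply: lt_nbhsl; exact: exprn_gt0.
Unshelve. all: by end_near. Qed.

End weights.

(** * The estimate of the means *)

(** Hoelder's inequality with prescribed bounds: [young_powR] is applied to a / A and b / B,
    multiplied by A^(nu-2) B^2 and integrated, the weights (nu-2)/nu and 2/nu adding up to 1. The
    divisions are why [A] and [B] are strictly positive. *)
Lemma young_Rintegral d (T : measurableType d) (R : realType)
    (mu : {measure set T -> \bar R}) (D : set T) (nu A B : R) (a b : T -> R) :
  measurable D -> 2 <= nu -> 0 < A -> 0 < B ->
  (forall x, 0 <= a x) -> (forall x, 0 <= b x) ->
  mu.-integrable D (EFin \o (fun x => a x `^ nu)) ->
  mu.-integrable D (EFin \o (fun x => b x `^ nu)) ->
  mu.-integrable D (EFin \o (fun x => a x `^ (nu - 2) * b x ^+ 2)) ->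
  \int[mu]_(x in D) a x `^ nu <= A `^ nu ->
  \int[mu]_(x in D) b x `^ nu <= B `^ nu ->
  \int[mu]_(x in D) (a x `^ (nu - 2) * b x ^+ 2) <= A `^ (nu - 2) * B ^+ 2.
Proof.
move=> mD nu2 A0 B0 a0 b0 ia ib iab aA bB.
have nu0 : 0 < nu by apply: lt_le_trans nu2.
pose c := A `^ (nu - 2) * B ^+ 2.
have c0 : 0 < c by rewrite mulr_gt0 ?powR_gt0 ?exprn_gt0.
pose ca := c * ((nu - 2) / nu) / A `^ nu.
pose cb := c * (2 / nu) / B `^ nu.
have An : 0 < A `^ nu by rewrite powR_gt0.
have Bn : 0 < B `^ nu by rewrite powR_gt0.
have ica : mu.-integrable D (EFin \o (fun x => ca * a x `^ nu)).
  exact: (integrableZl mD ca ia).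
have icb : mu.-integrable D (EFin \o (fun x => cb * b x `^ nu)).
  exact: (integrableZl mD cb ib).
apply: (@le_trans _ _ (\int[mu]_(x in D) (ca * a x `^ nu + cb * b x `^ nu))).
  apply: le_Rintegral => //; first exact: (integrableD mD ica icb).
  move=> x _.
  have := young_powR nu2 (divr_ge0 (a0 x) (ltW A0)) (divr_ge0 (b0 x) (ltW B0)).
  rewrite !powRM ?invr_ge0 ?(ltW A0) ?(ltW B0)// exprMn.
  have VV (z p : R) : 0 < z -> z^-1 `^ p = (z `^ p)^-1.
    by move=> z0; rewrite -powR_inv1 ?(ltW z0)// -powRrM mulN1r powRN.
  rewrite !VV// exprVn => h; rewrite -(ler_pM2l c0) in h.
  apply: le_trans (le_trans h _).
    rewrite /c le_eqVlt; apply/orP; left; apply/eqP.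
    have AA : A `^ (nu - 2) != 0 by rewrite gt_eqF// powR_gt0.
    have BB : B != 0 by rewrite gt_eqF.
    by field; rewrite AA BB.
  by rewrite /ca /cb mulrDr !mulrA ![_ / _ * _ `^ _]mulrAC.
rewrite RintegralD// !RintegralZl//.
have -> : A `^ (nu - 2) * B ^+ 2 = ca * A `^ nu + cb * B `^ nu.
  rewrite /ca /cb !divfK ?gt_eqF// -mulrDr -mulrDl subrK divff ?mulr1// gt_eqF//.
have ca0 : 0 <= ca.
  apply: divr_ge0 (ltW An); apply: (mulr_ge0 (ltW c0)).
  by apply: divr_ge0 (ltW nu0); rewrite subr_ge0.
have cb0 : 0 <= cb.
  apply: divr_ge0 (ltW Bn); apply: (mulr_ge0 (ltW c0)).
  by apply: divr_ge0 (ltW nu0).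
by apply: lerD; rewrite ler_wpM2l.
Qed.

Section integral_means.
Context {R : realType} {n : nat}.
Local Notation sigma := (sphere_measure R n).
Local Notation S := (@usphere R n).

Lemma ball_continuous_integrable (F : 'rV[R]_n -> R) (s : R) :
  (forall y, eball R n y -> {for y, continuous F}) -> 0 <= s < 1 ->
  sigma.-integrable S (EFin \o (fun z => F (s *: z))).
Proof.
move=> cF /andP[s0 s1]; apply: continuous_usphere_integrable => z; rewrite inE => Sz.
apply: continuous_scale_at; apply: cF; apply: usphere_eball => //.
by rewrite s1 (lt_le_trans _ s0)// ltrN10.
Qed.

(** The measure is carried by the sphere, where continuity makes the integral finite; afterwards the
    means are handled as real numbers. *)
Lemma integral_meanE (F : 'rV[R]_n -> R) (nu s : R) : 0 < nu ->
  (forall y, eball R n y -> {for y, continuous F}) -> 0 <= s < 1 ->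
  integral_mean nu F s =
    ((\int[sigma]_(z in S) `|F (s *: z)| `^ nu) `^ nu^-1)%:E.
Proof.
move=> nu0 cF s01; rewrite /integral_mean unlock.
rewrite (@ge0_integral_full_set _ _ _ _ S); last 3 first.
- exact: measurable_usphere.
- exact: sphere_measure_off.
- by move=> x; exact: poweR_ge0.
rewrite -poweR_EFin /Rintegral fineK//.
apply: integrable_fin_num; first exact: measurable_usphere.
apply: (@ball_continuous_integrable (fun y => `|F y| `^ nu)) => // y /cF c.
exact: (cvg_comp _ _ c (@continuous_abs_powR R nu (ltW nu0) (F y))).
Qed.

End integral_means.

Section mean_estimate.
Context {R : realType} {n : nat}.
Variables (omega : R -> R) (nu alpha beta : R) (u lambda : 'rV[R]_n -> R).
Hypothesis n2 : (2 <= n)%N.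
Hypothesis om : majorant omega.
Hypothesis nu2 : 2 <= nu.
Hypothesis alpha0 : 0 < alpha.
Hypothesis beta_le : beta <= alpha.
Hypothesis uC2 : C2_on (eball R n) u.
Hypothesis lambda_ge0 : {in eball R n, forall x, 0 <= lambda x}.
Hypothesis lambda_lt : (esup_eball (EFin \o lambda) < (2 * n%:R / nu)%:E)%E.
Hypothesis u_eq : {in eball R n, forall x, laplacian u x = lambda x * u x}.
Hypothesis u_fin : (unorm omega nu alpha beta u < +oo)%E.

Local Notation sigma := (sphere_measure R n).
Local Notation S := (@usphere R n).
Let Lam := fine (esup_eball (EFin \o lambda)).
Let normu := fine (unorm omega nu alpha beta u).
Let nu0 : 0 < nu. Proof. exact: lt_le_trans nu2. Qed.
Let nu2_ge0 : 0 <= nu - 2. Proof. by rewrite subr_ge0. Qed.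

Let powR_invK (x : R) : 0 <= x -> (x `^ nu^-1) `^ nu = x.
Proof. by move=> x0; rewrite -powRrM mulVf ?gt_eqF// powRr1. Qed.

Let w i := pderiv i u.

Let uP : C1_with (eball R n) u w.
Proof.
have [[cu du] _] := uC2; move=> x /mem_set bx; split; first exact: cu.
move=> i; have [d c] := du i; split; last exact: c.
by apply: derivableP; exact: d.
Qed.

Let wP i : C1_with (eball R n) (w i) (fun j => pderiv j (w i)).
Proof.
have [_ /(_ i)[cu du]] := uC2; move=> x /mem_set bx; split; first exact: cu.
move=> j; have [d c] := du j; split; last exact: c.
by apply: derivableP; exact: d.
Qed.

Let v x := `|u x| `^ nu.
(** The factor u |u|^(nu-2) is C^1 also across the zeros of u, so [h] is a continuous Hessian of [v]
    on the whole ball. *)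
Let g i x := nu * (u x * `|u x| `^ (nu - 2)) * w i x.
Let h i j x := nu * (nu - 1) * `|u x| `^ (nu - 2) * w j x * w i x +
  nu * (u x * `|u x| `^ (nu - 2)) * pderiv j (w i) x.

Let cu_abs p x : 0 <= p -> eball R n x -> {for x, continuous (fun x => `|u x| `^ p)}.
Proof.
by move=> p0 /uP[c _]; exact: (cvg_comp _ _ c (@continuous_abs_powR R p p0 (u x))).
Qed.

Let cg1 x : eball R n x ->
  {for x, continuous (fun x => nu * (u x * `|u x| `^ (nu - 2)))}.
Proof.
move=> bx; have [cu _] := uP bx.
exact: (continuous_mulr_at (@continuous_const R _ nu x) (continuous_mulr_at cu
    (cu_abs nu2_ge0 bx))).
Qed.

Let vP : C1_with (eball R n) v g.
Proof.
move=> x bx; have [cu du] := uP bx; split; first exact: cu_abs (ltW nu0) bx.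
move=> i; have [di ci] := du i; split; last exact: (continuous_mulr_at (cg1 bx) ci).
exact: (is_derive_comp_real di (is_derive_abs_powR (u x) nu2)).
Qed.

Let gP i : C1_with (eball R n) (g i) (h i).
Proof.
move=> x bx; have [cu du] := uP bx; have [cw dw] := wP i bx.
split; first exact: (continuous_mulr_at (cg1 bx) cw).
move=> j; have [dj cj] := du j; have [dij cij] := dw j; split.
  have d1 := is_derive_comp_real dj (is_derive_abs_powR_id (u x) nu2_ge0).
  have d2 := is_deriveM (is_deriveZ nu d1) dij.
  apply: (is_derive_eq d2); rewrite /h.
  have scE (a b : R) : a *: (b : R^o) = a * b by [].
  rewrite /GRing.scale/= -[nu *: _]/(nu * _).
  move: (u x) (`|u x| `^ (nu - 2)) (w i x) (w j x) (pderiv j (w i) x) => a b c d e.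
  by ring.
have c1 := continuous_mulr_at (continuous_mulr_at (continuous_mulr_at
    (@continuous_const R _ (nu * (nu - 1)) x) (cu_abs nu2_ge0 bx)) cj) cw.
have c2 := continuous_mulr_at (cg1 bx) cij.
exact: (cvgD c1 c2).
Qed.

Let laplacian_v x : eball R n x -> \sum_i h i i x =
  nu * (nu - 1) * (`|u x| `^ (nu - 2) * enorm (grad u x) ^+ 2) +
  nu * (lambda x * `|u x| `^ nu).
Proof.
move=> bx; rewrite big_split/=; congr (_ + _).
  rewrite enorm_sqr /sqnorm mulrA mulr_sumr; apply: eq_bigr => i _.
  by rewrite mxE expr2 !mulrA.
rewrite -mulr_sumr -/(laplacian u x) (u_eq (mem_set bx)).
by rewrite -(abs_powR_split (u x) nu2); ring.
Qed.

Let origin_ball : eball R n 0.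
Proof.
by rewrite eball_sqnorm /sqnorm big1 ?ltr01// => i _; rewrite mxE expr0n.
Qed.

Let esup_lambda_fin : esup_eball (EFin \o lambda) \is a fin_num.
Proof.
rewrite fin_numElt (lt_le_trans lambda_lt (leey _)) andbT.
apply: (@lt_le_trans _ _ (lambda 0)%:E); first exact: ltNyr.
by apply: ereal_sup_ubound; exists 0.
Qed.

Let lambda_le x : eball R n x -> lambda x <= Lam.
Proof.
move=> bx; rewrite -lee_fin fineK//.
by apply: ereal_sup_ubound; exists x.
Qed.

Let Lam_ge0 : 0 <= Lam.
Proof.
by apply: le_trans (lambda_le origin_ball); apply: lambda_ge0; exact/mem_set.
Qed.

Let Lam_lt : Lam < 2 * n%:R / nu.
Proof. by rewrite -lte_fin fineK. Qed.

Let I (s : R) := \int[sigma]_(z in S) v (s *: z).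
Let E (s : R) := \int[sigma]_(z in S) enorm (grad u (s *: z)) `^ nu.

Let cgrad x : eball R n x -> {for x, continuous (fun x => enorm (grad u x))}.
Proof.
move=> bx; have c : {for x, continuous (fun x => sqnorm (grad u x))}.
  apply: (@cvg_sumr _ _ _ _ (nbhs x)) => i.
  under eq_fun do rewrite mxE expr2; rewrite mxE expr2.
  by have [cw _] := wP i bx; exact: (cvgM cw cw).
exact: (cvg_comp _ _ c (@sqrt_continuous R (sqnorm (grad u x)))).
Qed.

Let ball01 (s : R) : 0 <= s < 1 -> -1 < s < 1.
Proof. by move=> /andP[s0 ->]; rewrite andbT (lt_le_trans _ s0)// ltrN10. Qed.

Let mean_u s : 0 <= s < 1 -> integral_mean nu u s = ((I s) `^ nu^-1)%:E.
Proof. by move=> s01; apply: integral_meanE => // x /uP[]. Qed.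

Let mean_grad s : 0 <= s < 1 ->
  integral_mean nu (fun x => enorm (grad u x)) s = ((E s) `^ nu^-1)%:E.
Proof.
move=> s01.
rewrite (@integral_meanE _ _ (fun x => enorm (grad u x)) _ _ nu0 (fun x bx => cgrad
    bx) s01).
suff -> : \int[sigma]_(z in S) `|enorm (grad u (s *: z))| `^ nu = E s by [].
by apply: eq_Rintegral => z _; rewrite ger0_norm// enorm_ge0.
Qed.

Let unorm_ge0_fin : (0 <= esup_eball (fun x : 'rV[R]_n =>
     integral_mean nu (fun y => enorm (grad u y)) (enorm x)
     * (omega (phi alpha beta (enorm x)))%:E) <= normu%:E)%E.
Proof.
set F := esup_eball _.
have F0 : (0 <= F)%E.
  apply: (@le_trans _ _ (integral_mean nu (fun y => enorm (grad u y)) (enorm (0 : 'rV[R]_n))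
     * (omega (phi alpha beta (enorm (0 : 'rV[R]_n))))%:E)%E).
    apply: mule_ge0; first exact: Lnorm_ge0.
    have [_ om0 _ _ _] := om; rewrite lee_fin; apply: om0.
    by apply: mulr_ge0; exact: powR_ge0.
  by apply: ereal_sup_ubound; exists 0.
rewrite F0/= /normu fineK; first by rewrite /unorm leeDr// lee_fin.
by rewrite ge0_fin_numE// /unorm adde_ge0// lee_fin.
Qed.

Let normu_ge0 : 0 <= normu.
Proof. by case/andP : unorm_ge0_fin => a b; rewrite -lee_fin (le_trans a b). Qed.

Let E_ge0 s : 0 <= E s.
Proof. by apply: Rintegral_ge0 => z _; exact: powR_ge0. Qed.

Let I_ge0 s : 0 <= I s.
Proof. by apply: Rintegral_ge0 => z _; exact: powR_ge0. Qed.

(** [N] is any upper bound of the norm of [u], so that a positive one is available when that norm is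
    0. *)
Let E_le s N : 0 <= s < 1 -> normu <= N ->
  E s <= (N / (omega 1 * phi alpha beta s)) `^ nu.
Proof.
move=> s01 nN; have [] := majorant_phi alpha0 beta_le om s01; move=> o1 ophi.
have p0 := phi_gt0 alpha beta s01.
have op0 : 0 < omega 1 * phi alpha beta s by rewrite mulr_gt0.
have N0 : 0 <= N by apply: le_trans nN.
rewrite -(powR_invK (E_ge0 s)) ge0_ler_powR ?nnegrE ?(ltW nu0) ?powR_ge0 ?divr_ge0
    ?(ltW op0)//.
rewrite ler_pdivlMr//; apply: le_trans nN; rewrite -lee_fin.
apply: le_trans (proj2 (andP unorm_ge0_fin)).
apply: (@le_trans _ _ (E s `^ nu^-1 * omega (phi alpha beta s))%:E).
  by rewrite lee_fin ler_wpM2l// powR_ge0.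
pose i0 : 'I_n := Ordinal (ltnW n2).
(* The supremum runs over points of the ball; this is one of norm s. *)
pose x : 'rV[R]_n := s *: 'e_i0.
have xs : enorm x = s.
  rewrite enormZ ger0_norm; last by case/andP : s01.
  rewrite enormE /sqnorm (bigD1 i0)//= mxE !eqxx expr1n big1 ?addr0 ?sqrtr1
      ?mulr1// => i ii.
  by rewrite mxE (negbTE ii) andbF expr0n.
apply: ereal_sup_ubound; exists x; first by rewrite /eball/= xs; case/andP : s01.
by rewrite xs mean_grad// EFinM.
Qed.

Let int_v s : 0 <= s < 1 -> sigma.-integrable S (EFin \o (fun z => v (s *: z))).
Proof. by apply: ball_continuous_integrable => x /vP[]. Qed.

Let int_E s : 0 <= s < 1 ->
  sigma.-integrable S (EFin \o (fun z => enorm (grad u (s *: z)) `^ nu)).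
Proof.
apply: (@ball_continuous_integrable _ _ (fun y => enorm (grad u y) `^ nu)) => y by_.
rewrite (_ : (fun _ => _) = fun y => `|enorm (grad u y)| `^ nu).
  exact: (cvg_comp _ _ (cgrad by_) (@continuous_abs_powR R nu (ltW nu0) _)).
by apply/funext => z; rewrite ger0_norm// enorm_ge0.
Qed.

Let int_prod s : 0 <= s < 1 -> sigma.-integrable S
  (EFin \o (fun z => `|u (s *: z)| `^ (nu - 2) * enorm (grad u (s *: z)) ^+ 2)).
Proof.
apply: (@ball_continuous_integrable _ _
  (fun y => `|u y| `^ (nu - 2) * enorm (grad u y) ^+ 2)) => y by_.
have c := cgrad by_.
have c2 := continuous_mulr_at (cu_abs nu2_ge0 by_) (continuous_mulr_at c c); exact: c2.
Qed.

Let mean_laplacian_le s A N : 0 <= s < 1 -> 0 < A -> 0 < N -> normu <= N ->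
  I s <= A `^ nu ->
  \int[sigma]_(z in S) \sum_i h i i (s *: z) <=
    nu * (nu - 1) * (A `^ (nu - 2) * (N / (omega 1 * phi alpha beta s)) ^+ 2)
    + nu * (Lam * A `^ nu).
Proof.
move=> s01 A0 N0 nN IA.
have mS := @measurable_usphere R n.
have [] := majorant_phi alpha0 beta_le om s01; move=> o1 _.
have B0 : 0 < N / (omega 1 * phi alpha beta s).
  by rewrite divr_gt0// mulr_gt0// phi_gt0.
have nn : 0 <= nu * (nu - 1) by rewrite mulr_ge0 ?(ltW nu0)// subr_ge0 (le_trans _
    nu2)// ler1n.
have i1 := integrableZl mS (nu * (nu - 1)) (int_prod s01).
have i2 := integrableZl mS (nu * Lam) (int_v s01).
have i3 : sigma.-integrable S (EFin \o (fun z => \sum_i h i i (s *: z))).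
  apply: (@ball_continuous_integrable _ _ (fun y => \sum_i h i i y)) => // y by_.
  by apply: (@cvg_sumr _ _ _ _ (nbhs y)) => i; have [_ /(_ i)[]] := gP i by_.
apply: (@le_trans _ _ (\int[sigma]_(z in S) (nu * (nu - 1) *
   (`|u (s *: z)| `^ (nu - 2) * enorm (grad u (s *: z)) ^+ 2) + nu * Lam * v (s *: z)))).
  apply: le_Rintegral => //; first exact: (integrableD mS i1 i2).
  move=> z Sz; have bz := usphere_eball (ball01 s01) Sz.
  rewrite laplacian_v// lerD2l -mulrA ler_pM2l// ler_wpM2r ?powR_ge0//.
  exact: lambda_le.
rewrite RintegralD// !RintegralZl//; [|exact: int_v|exact: int_prod].
apply: lerD; last by rewrite -mulrA ler_pM2l// ler_wpM2l.
apply: ler_wpM2l => //.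
apply: (young_Rintegral mS nu2 A0 B0) => //.
- by move=> z; exact: enorm_ge0.
- exact: int_v.
- exact: int_E.
- exact: int_prod.
- exact: E_le.
Qed.

Let I_mono s r : 0 <= s -> s <= r -> r < 1 -> I s <= I r.
Proof.
apply: (radial_ode_homo n2 (is_derive_mean1 vP gP) (is_derive_mean2 gP)) => t t01.
rewrite (mean_ode gP t01); case/andP : t01 => t0 t1.
apply: mulr_ge0 (ltW t0) _; apply: Rintegral_ge0 => z Sz.
have bz : eball R n (t *: z) by apply: usphere_eball => //; apply: ball01; rewrite (ltW t0).
rewrite laplacian_v//; apply: addr_ge0.
  apply: mulr_ge0; last by rewrite mulr_ge0 ?powR_ge0 ?sqr_ge0.
  by rewrite mulr_ge0 ?(ltW nu0)// subr_ge0 (le_trans _ nu2)// ler1n.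
by rewrite !mulr_ge0 ?powR_ge0 ?(ltW nu0)// lambda_ge0// mem_set.
Qed.

Variables (wt dwt : R -> R).
Hypothesis wtP : forall t : R, 0 < t < 1 -> is_derive t 1 wt (dwt t).
Hypothesis cwt : {within `[0, 1], continuous wt}.
Hypothesis wt_ge0 : forall t : R, 0 < t < 1 -> 0 <= wt t.
Hypothesis wt0 : wt 0 = 0.
Hypothesis wt1 : wt 1 = 0.
Hypothesis wtE : forall t : R, 0 < t < 1 -> t * dwt t = (n%:R - 1) * wt t - t.

Let J (r : R) := \int[lebesgue_measure]_(t in `[0, 1]) (wt t / phi alpha beta (r * t) ^+ 2).

Let I_le r A N : 0 <= r < 1 -> 0 < A -> 0 < N -> normu <= N -> I r = A `^ nu ->
  I r - I 0 <= r ^+ 2 * (nu * (nu - 1) * A `^ (nu - 2) * N ^+ 2 / omega 1 ^+ 2 * J r)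
    + nu * Lam * r ^+ 2 / (2 * n%:R) * A `^ nu.
Proof.
move=> r01 A0 N0 nN IA; have [] := majorant_phi alpha0 beta_le om r01; move=> o1 _.
have [->|rn0] := eqVneq r 0; first by rewrite subrr expr0n mul0r mulr0 !mul0r addr0.
have n0 : (0 : R) < n%:R by rewrite ltr0n (ltnW n2).
pose b := nu * (Lam * A `^ nu).
pose a := nu * (nu - 1) * A `^ (nu - 2) * N ^+ 2 / omega 1 ^+ 2.
(* For b s^2 / (2n) the expression s y'' + (n-1) y' equals b s. Subtracting it removes the constant
   [b] from the bound, without computing the integral of the weight. *)
pose y s := I s - b / (2 * n%:R) * s ^+ 2.
pose y1 s := mean1 g s - b / (2 * n%:R) * (2%:R * s ^+ 1).
pose y2 s := mean2 h s - b / (2 * n%:R) * (2%:R * 1).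
have yP (s : R) : -1 < s < 1 -> is_derive s 1 y (y1 s).
  move=> s1; exact: (is_deriveB (is_derive_mean1 vP gP s1)
    (is_deriveZ (b / (2 * n%:R)) (is_deriveXn 2 s))).
have y1P (s : R) : -1 < s < 1 -> is_derive s 1 y1 (y2 s).
  move=> s1; have := is_deriveXn 1 s; rewrite mulr1 => hX.
  apply: (is_derive_eq (is_deriveB (is_derive_mean2 gP s1)
    (is_deriveZ (b / (2 * n%:R)) (is_deriveZ 2%:R hX)))).
  by rewrite /y2 /GRing.scale/=.
pose k t := a / phi alpha beta (r * t) ^+ 2.
have cphi := @within_continuous_phiV R alpha beta r r01.
have ck : {within `[0, 1], continuous k}.
  apply: within_cM => //; apply: continuous_subspaceT; exact: continuous_const.
have yk (t : R) : 0 < t < 1 ->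
    r * t * y2 (r * t) + (n%:R - 1) * y1 (r * t) <= r * t * k t.
  move=> /andP[t0 t1]; case/andP : (r01) => r0 r1.
  have rt0 : 0 < r * t by rewrite mulr_gt0// lt_neqAle eq_sym rn0.
  have rt1 : r * t < 1 by apply: le_lt_trans r1; rewrite ler_piMr// ltW.
  have rt01 : 0 <= r * t < 1 by rewrite ltW.
  have := mean_ode gP (introT andP (conj rt0 rt1)); set L := Rintegral _ _ _ => ode.
  have -> : r * t * y2 (r * t) + (n%:R - 1) * y1 (r * t) =
      r * t * (L - b).
    rewrite [RHS]mulrBr -ode /y1 /y2; field.
    by rewrite gt_eqF.
  rewrite ler_pM2l// lerBlDr.
  apply: le_trans (mean_laplacian_le rt01 A0 N0 nN _) _.
    by rewrite -IA; apply: I_mono => //; rewrite ?(ltW rt0)// ler_piMr// ltW.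
  rewrite lerD2r /k /a le_eqVlt; apply/orP; left; apply/eqP.
  by field; rewrite !gt_eqF// phi_gt0.
have := radial_ode_le yP y1P wtP cwt wt_ge0 wt0 wt1 wtE r01 ck yk.
have -> : \int[lebesgue_measure]_(t in `[0, 1]) (wt t * k t) = a * J r.
  rewrite -RintegralZl//.
    by apply: eq_Rintegral => t _; rewrite /k; ring.
  apply: continuous_compact_integrable; first exact: segment_compact.
  exact: within_cM.
have -> : y 0 = I 0 by rewrite /y expr0n mulr0 subr0.
have -> : nu * Lam * r ^+ 2 / (2 * n%:R) * A `^ nu = b / (2 * n%:R) * r ^+ 2.
  by rewrite /b; ring.
by rewrite -lerBlDr addrAC.
Qed.

Let I0E : exists2 m, 0 <= m <= 1 & I 0 = `|u 0| `^ nu * m.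
Proof.
have mS := @measurable_usphere R n.
exists (fine (sigma S)); last first.
  have -> : I 0 = \int[sigma]_(z in S) v 0.
    by apply: eq_Rintegral => z _; rewrite scale0r.
  by rewrite Rintegral_cst.
rewrite fine_ge0//=; have Sle : (sigma S <= 1)%E.
  by apply: le_trans (@sphere_measure_le1 R n); apply: le_measure; rewrite ?inE.
by rewrite -lee_fin fineK// ge0_fin_numE// (le_lt_trans Sle)// ltry.
Qed.

(** Prepares the division by A^(nu-2). If |u 0| <= A, split off |u 0|^2 from |u 0|^nu, the mass [m]
    being at most 1; otherwise use I 0 <= A^nu and A^2 <= |u 0|^2. *)
Let I0_le A : 0 < A -> I 0 <= A `^ nu -> I 0 <= `|u 0| ^+ 2 * A `^ (nu - 2).
Proof.
move=> A0; have [m /andP[m0 m1] ->] := I0E.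
have [uA|Au] := leP `|u 0| A => IA.
  apply: (@le_trans _ _ (`|u 0| `^ nu)); first by rewrite ler_piMr// powR_ge0.
  rewrite -[X in X `^ nu]normr_id -abs_powR_split// normr_id ler_wpM2l ?sqr_ge0//.
  by rewrite ge0_ler_powR// nnegrE// ltW.
apply: le_trans IA _; rewrite -(gtr0_norm A0) -abs_powR_split// (gtr0_norm A0).
by rewrite ler_wpM2r ?powR_ge0// lerXn2r ?nnegrE ?(ltW A0)// ltW.
Qed.

(** Young's inequality was applied with a strictly positive [N]. If the norm of [u] is 0, the
    estimate is passed to the limit N -> 0, through N^2 = e / (|K| + 1). *)
Let le_scaled_sqr (x y K : R) :
  (forall N, 0 < N -> normu <= N -> x <= y + K * N ^+ 2) -> x <= y + K * normu ^+ 2.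
Proof.
move=> H; have [nE|n0] := eqVneq normu 0; last by apply: H; rewrite // lt_neqAle
    eq_sym n0 normu_ge0.
rewrite nE expr0n mulr0 addr0; apply/ler_addgt0Pr => e e0.
have K1 : 0 < `|K| + 1 by rewrite ltr_wpDl.
have eK : 0 < e / (`|K| + 1) by rewrite divr_gt0.
have := H (Num.sqrt (e / (`|K| + 1))).
rewrite nE sqrtr_gt0 eK sqr_sqrtr ?(ltW eK)// => /(_ isT (sqrtr_ge0 _)) xy.
apply: le_trans xy _; rewrite lerD2l.
apply: (@le_trans _ _ (`|K| * (e / (`|K| + 1)))).
  by rewrite ler_wpM2r ?(ltW eK)// ler_norm.
by rewrite mulrCA ler_piMr ?(ltW e0)// ler_pdivrMr// mul1r lerDl.
Qed.

Lemma mean_le (r : R) : 0 <= r < 1 ->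
  (integral_mean nu u r <=
    ((Num.sqrt (1 - r ^+ 2 * nu / (2 * n%:R) * Lam))^-1 *
      Num.sqrt (`|u 0| ^+ 2 + nu * (nu - 1) / omega 1 ^+ 2 * normu ^+ 2 * r ^+ 2 *
          J r))%:E)%E.
Proof.
move=> r01; rewrite mean_u// lee_fin.
have n0 : (0 : R) < n%:R by rewrite ltr0n (ltnW n2).
set D := 1 - _; set A := I r `^ nu^-1.
have IA : I r = A `^ nu := esym (powR_invK (I_ge0 r)).
have [A0|A0] := eqVneq A 0.
  by rewrite A0 mulr_ge0 ?invr_ge0 ?sqrtr_ge0.
have {}A0 : 0 < A by rewrite lt_neqAle eq_sym A0 powR_ge0.
(* The smallness of sup lambda enters here: r^2 Lam nu / (2n) <= Lam nu / (2n) < 1. *)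
have D0 : 0 < D.
  rewrite /D subr_gt0.
  have -> : r ^+ 2 * nu / (2 * n%:R) * Lam = r ^+ 2 * (Lam * nu / (2 * n%:R)) by ring.
  apply: (@le_lt_trans _ _ (Lam * nu / (2 * n%:R))).
    rewrite ler_piMl//; last by case/andP : r01 => r0 r1; rewrite expr_le1// ltW.
    by apply: divr_ge0; apply: mulr_ge0 => //; exact: ltW.
  by rewrite ltr_pdivrMr ?mulr_gt0// mul1r -ltr_pdivlMr.
have key : D * A ^+ 2 <= `|u 0| ^+ 2 + nu * (nu - 1) / omega 1 ^+ 2 * r ^+ 2 * J r
    * normu ^+ 2.
  apply: le_scaled_sqr => N N0 nN.
  have Ap : 0 < A `^ (nu - 2) by rewrite powR_gt0.
  have h1 := I_le r01 A0 N0 nN IA.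
  have h2 : I 0 <= `|u 0| ^+ 2 * A `^ (nu - 2).
    by apply: I0_le => //; rewrite -IA; apply: I_mono => //; case/andP : r01.
  have A2 : A `^ nu = A ^+ 2 * A `^ (nu - 2).
    by rewrite -[X in X `^ nu](gtr0_norm A0) -abs_powR_split// (gtr0_norm A0).
  rewrite -(ler_pM2r Ap).
  move: h1; rewrite IA A2 -lerBlDr => h1.
  have -> : D * A ^+ 2 * A `^ (nu - 2) = A ^+ 2 * A `^ (nu - 2) - I 0 -
      nu * Lam * r ^+ 2 / (2 * n%:R) * (A ^+ 2 * A `^ (nu - 2)) + I 0.
    by rewrite /D; ring.
  apply: le_trans (lerD h1 h2) _.
  by rewrite le_eqVlt; apply/orP; left; apply/eqP; ring.
have sD : 0 < Num.sqrt D by rewrite sqrtr_gt0.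
rewrite ler_pdivlMl//.
rewrite -[X in _ * X](gtr0_norm A0) -sqrtr_sqr -sqrtrM ?(ltW D0)//.
rewrite ler_wsqrtr//; apply: le_trans key _.
by rewrite lerD2l le_eqVlt; apply/orP; left; apply/eqP; ring.
Qed.

End mean_estimate.

Theorem corollary1 (R : realType) (n : nat) (omega : R -> R)
    (nu alpha beta : R) (u lambda : 'rV[R]_n -> R) :
  (2 <= n)%N ->
  majorant omega ->
  2 <= nu ->
  0 < alpha ->
  beta <= alpha ->
  C2_on (eball R n) u ->
  {in eball R n, continuous lambda} ->
  {in eball R n, forall x, 0 <= lambda x} ->
  (esup_eball (EFin \o lambda) < (2 * n%:R / nu)%:E)%E ->
  {in eball R n, forall x, laplacian u x = lambda x * u x} ->
  (unorm omega nu alpha beta u < +oo)%E ->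
  let normu := fine (unorm omega nu alpha beta u) in
  let Cstar := fun r : R =>
    Num.sqrt (1 - r ^+ 2 * nu / (2 * n%:R) * fine (esup_eball (EFin \o lambda))) in
  ((3 <= n)%N -> forall r : R, 0 <= r < 1 ->
    (integral_mean nu u r <=
      ((Cstar r)^-1 * Num.sqrt (`|u 0| ^+ 2
        + nu * (nu - 1) / ((n%:R - 2) * omega 1 ^+ 2) * normu ^+ 2 * r ^+ 2
          * \int[lebesgue_measure]_(t in `[0, 1])
              (t * (1 - t ^+ (n - 2)) / phi alpha beta (r * t) ^+ 2)))%:E)%E)
  /\
  (n = 2%N -> forall r : R, 0 <= r < 1 ->
    (integral_mean nu u r <=
      ((Cstar r)^-1 * Num.sqrt (`|u 0| ^+ 2
        + nu * (nu - 1) / omega 1 ^+ 2 * normu ^+ 2 * r ^+ 2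
          * \int[lebesgue_measure]_(t in `[0, 1])
              (t * ln (t^-1) / phi alpha beta (r * t) ^+ 2)))%:E)%E).
Proof.
move=> n2 om nu2 alpha0 beta_le uC2 _ lam0 lam_lt u_eq u_fin normu Cstar.
have main := mean_le n2 om nu2 alpha0 beta_le uC2 lam0 lam_lt u_eq u_fin.
split=> [n3 r r01|nE r r01]; last first.
  apply: (main weight2 dweight2) => //.
  - by move=> t /andP[t0 _]; exact: is_derive_weight2.
  - exact: within_continuous_weight2.
  - exact: weight2_ge0.
  - exact: weight2_0.
  - exact: weight2_1.
  - by move=> t _; rewrite nE; exact: weight2E.
have n2_neq0 : n%:R - 2 != 0 :> R by rewrite subr_eq0 eqr_nat gtn_eqF.
have cw : {within `[0, 1], continuous (@weight R n)}.
  by apply: continuous_subspaceT => t; exact: is_derive_continuous (is_derive_weight n3 t).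
have := main (weight n) (dweight n) (fun t _ => is_derive_weight n3 t) cw
  (@weight_ge0 R n n3) (@weight0 R n) (@weight1 R n) (fun t _ => weightE n3 t) r r01.
(* [weight] contains the factor 1/(n-2) of the Green function, which the statement keeps outside the
   integral. *)
have -> : \int[lebesgue_measure]_(t in `[0, 1])
      (t * (1 - t ^+ (n - 2)) / phi alpha beta (r * t) ^+ 2) =
    (n%:R - 2) * \int[lebesgue_measure]_(t in `[0, 1])
      (weight n t / phi alpha beta (r * t) ^+ 2).
  rewrite -RintegralZl//.
    apply: eq_Rintegral => t _; rewrite /weight.
    by rewrite !mulrA divff// mul1r.
  apply: continuous_compact_integrable; first exact: segment_compact.
  by apply: within_cM cw _; exact: within_continuous_phiV.
set J := Rintegral _ _ _.
suff -> : nu * (nu - 1) / omega 1 ^+ 2 * normu ^+ 2 * r ^+ 2 * J =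
    nu * (nu - 1) / ((n%:R - 2) * omega 1 ^+ 2) * normu ^+ 2 * r ^+ 2 *
      ((n%:R - 2) * J) by [].
have om1 : omega 1 != 0.
  by have [_ _ inc om0 _] := om; rewrite gt_eqF// -{1}om0; exact: inc.
by field; rewrite om1.
Qed.
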